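(* Let $q\ge3$, let $\mathbb{T}_q$ be the homogeneous tree of degree $q$ with root $e$, and let $(A(n))_{n\ge1}$ be the Internal DLA on $\mathbb{T}_q$ started at $e$ and associated with the Simple Random Walk. Let $V(n)=\#B(n)$, where $B(r)$ is the ball of radius $r$ around $e$, and let $\partial B(r)$ be its external boundary. Then for any constant $C_o<(\ln(q-1)/\ln q)^{1/2}$, $$\mathbb{P}\left[A(V(n))\cap\partial B(n+C_o\sqrt{n})=\emptyset\ \text{ for infinitely many } n\right]=0 .$$
   Context: $\mathbb{T}_q$ is the infinite tree in which every vertex has exactly $q$ neighbours, with a distinguished vertex $e$; $|z|$ denotes the graph distance from $e$ to $z$. The Simple Random Walk is the nearest neighbour Markov chain on $\mathbb{T}_q$ moving at each step to a uniformly chosen neighbour. For real $r$, $B(r)=\{z:|z|\le r\}$ and $\partial B(r)=\{z\notin B(r): z \text{ has a neighbour in } B(r)\}$. (These balls coincide with the balls $\{z:d(e,z)\le Kr\}$ for the hitting distance $d(x,y)=-\ln F(x,y)$, where $F(x,y)$ is the probability that the walk started at $x$ ever hits $y$ and $K=\ln(q-1)$, since $F(e,z)=(q-1)^{-|z|}$.) One has $V(n)=\frac{q(q-1)^n-2}{q-2}$ for integers $n\ge 0$. Internal DLA: let $(S^n(\cdot))_{n\ge1}$ be i.i.d. Simple Random Walks on $\mathbb{T}_q$, all started at $e$. Define random finite sets by $A(1)=\{e\}$ and $A(n+1)=A(n)\cup\{S^{n+1}(\tau_{A(n)^c})\}$, where $\tau_{A(n)^c}$ is the first time $k\ge 0$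 at which $S^{n+1}(k)\notin A(n)$ (almost surely finite). The index $n$ ranges over positive integers. *)

(* Defs.v *)
From HB Require Import structures.
From mathcomp Require Import all_boot all_order all_algebra finmap.
From mathcomp Require Import all_classical all_reals all_analysis.

Set Implicit Arguments.
Unset Strict Implicit.
Unset Printing Implicit Defensive.

Import Order.TTheory GRing.Theory Num.Theory.

Local Open Scope classical_set_scope.
Local Open Scope ring_scope.

Definition neighbours (T : Type) (adj : rel T) (x : T) : set T :=
  [set y | adj x y].

(* Connected, without cycles, every vertex having exactly q neighbours.  A
   two-element sequence [:: x; y] with x, y adjacent satisfies [ucycle], so
   the genuine cycles are those of size at least 3. *)
Definition homogeneous_tree (T : eqType) (adj : rel T) (q : nat) : Prop :=
  [/\ symmetric adj /\ irreflexive adj,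
      forall x y : T, exists2 p : seq T, path adj x p & last x p = y,
      forall c : seq T, ucycle adj c -> (size c <= 2)%N &
      forall x : T, (neighbours adj x #= `I_q)%card].

(* [walk_length adj x y n]: there is a path with n edges from x to y. *)
Definition walk_length (T : Type) (adj : rel T) (x y : T) : set nat :=
  [set n | exists p : seq T, [/\ path adj x p, last x p = y & size p = n]].

(* The least length of a path (0 if there is none, which does not occur in a
   connected graph). *)
Definition graph_dist (T : Type) (adj : rel T) (x y : T) : nat :=
  xget 0%N [set n | walk_length adj x y n /\
                    forall m, walk_length adj x y m -> (n <= m)%N].

Definition gball (R : realType) (T : Type) (adj : rel T) (e : T) (r : R) :
    set T :=
  [set z | (graph_dist adj e z)%:R <= r].

Definition gboundary (R : realType) (T : Type) (adj : rel T) (e : T) (r : R) :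
    set T :=
  [set z | ~ gball adj e r z /\ exists2 y, adj z y & gball adj e r y].

Definition gvolume (R : realType) (T : choiceType) (adj : rel T) (e : T)
    (r : R) : nat :=
  #|` fset_set (gball adj e r)|%fset.

Definition srw_step (R : realType) (T : choiceType) (adj : rel T) (x y : T) :
    R :=
  if adj x y then (#|` fset_set (neighbours adj x)|%fset)%:R^-1 else 0.

(* T carries the discrete sigma-algebra.  The last clause is the Markov
   property, multiplied out to avoid conditioning on null events. *)
Definition simple_random_walk (R : realType) (d : measure_display)
    (Omega : measurableType d) (P : probability Omega R)
    (T : countType) (adj : rel T) (e : T) (X : nat -> Omega -> T) : Prop :=
  [/\ forall k x, measurable (X k @^-1` [set x]),
      P (X 0%N @^-1` [set e]) = 1%E &
      forall (k : nat) (x : nat -> T),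
        P (\bigcap_(j < k.+2) (X j @^-1` [set x j])) =
        (P (\bigcap_(j < k.+1) (X j @^-1` [set x j])) *
         (srw_step R adj (x k) (x k.+1))%:E)%E].

Definition process_sigma (Omega : Type) (T : Type) (X : nat -> Omega -> T) :
    set (set Omega) :=
  <<s [set E | exists k x, E = X k @^-1` [set x]] >>.

(* Mutual independence of the processes S i, i >= 1. *)
Definition independent_processes (R : realType) (d : measure_display)
    (Omega : measurableType d) (P : probability Omega R)
    (T : Type) (S : nat -> nat -> Omega -> T) : Prop :=
  forall (J : seq nat) (E : nat -> set Omega),
    uniq J -> (forall i, i \in J -> (0 < i)%N) ->
    (forall i, i \in J -> process_sigma (S i) (E i)) ->
    P (\bigcap_(i in [set` J]) E i) = (\prod_(i <- J) P (E i))%E.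

Definition first_exit (T : Type) (A : set T) (s : nat -> T) (k : nat) : Prop :=
  ~ A (s k) /\ forall j, (j < k)%N -> A (s j).

(* [idla e S n w] is A(n) at the outcome w, for n >= 1; the value at 0 is a
   dummy.  The walk S^n is S n and S 0 is never used.  If S^(n+1) never leaves
   A(n), an event of probability 0, no point is added. *)
Fixpoint idla (Omega : Type) (T : Type) (e : T) (S : nat -> nat -> Omega -> T)
    (n : nat) (w : Omega) : set T :=
  match n with
  | 0 => set0
  | 1 => [set e]
  | (m.+1 as n').+1 =>
      let A := idla e S n' w in
      A `|` [set z | exists2 k, first_exit A (fun j => S n'.+1 j w) k &
                                z = S n'.+1 k w]
  end.

(* Main.v *)
Require Import Defs.
From HB Require Import structures.
From mathcomp Require Import all_boot all_order all_algebra finmap.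
From mathcomp Require Import all_classical all_reals all_analysis.
From mathcomp Require Import zify ring lra.

Set Implicit Arguments.
Unset Strict Implicit.
Unset Printing Implicit Defensive.

Import Order.TTheory GRing.Theory Num.Theory.

Local Open Scope classical_set_scope.
Local Open Scope ring_scope.

(* Write L = n - s with s = o(sqrt n), and let the tree have D_l vertices at
   level l.  Once the ball of radius l - 1 is occupied, every further walk meets
   level l for the first time at a uniformly distributed vertex, whatever the
   other walks did; by coupon collecting, n q D_l walks (up to a constant) leave
   no vertex of level l free.  Filling the levels below L one after the other
   thus takes about n q V(L) walks, which is much less than V(n) as s is much
   larger than log n.  There remain enough walks for m + 1 blocks of 2 D_L walks.
   Fix a path of m edges going down from each vertex v of level L.  If in every
   block some walk reaches level L at v and then follows the path of v straight
   away, then each block adds a vertex to the cluster along this path, which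
   ends at level L + m.  This has probability at least (q^-m / 2)^(m+1) for each
   v, and for different v these events are negatively correlated, so that by
   Chebyshev's inequality one of them occurs unless
   (q-1)^L (q^-m / 2)^(m+1) is small.  With m = C sqrt n + o(sqrt n) this
   number is exponentially large exactly when C^2 ln q < ln (q-1), and the
   Borel-Cantelli lemma concludes. *)

(** * Levels of the tree *)

Definition level_size (q l : nat) : nat := if l is k.+1 then (q * q.-1 ^ k)%N else 1%N.

Section Tree.
Variables (T : countType) (adj : rel T) (q : nat).
Hypothesis hT : homogeneous_tree adj q.
Variable e : T.

Notation lev := (graph_dist adj e).

Let adjC : symmetric adj. Proof. by case: hT => -[]. Qed.
Let adjI x : adj x x = false. Proof. by case: hT => -[_ ->]. Qed.

Lemma graph_distP x : walk_length adj e x (lev x) /\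
  forall m, walk_length adj e x m -> (lev x <= m)%N.
Proof.
have [_ conn _ _] := hT.
have [p pp lp] := conn e x.
have ex : exists n, `[< walk_length adj e x n >].
  by exists (size p); apply/asboolP; exists p.
have exm : exists n, walk_length adj e x n /\
    forall m, walk_length adj e x m -> (n <= m)%N.
  case: (ex_minnP ex) => m /asboolP wm mmin; exists m; split=> // k wk.
  by apply: mmin; apply/asboolP.
exact: (xgetPex 0%N exm).
Qed.

Lemma lev_root : lev e = 0%N.
Proof.
have [_ h] := graph_distP e.
by apply/eqP; rewrite -leqn0; apply: h; exists [::].
Qed.

Lemma lev_eq0 x : lev x = 0%N -> x = e.
Proof.
have [[p [_ lp sp]] _] := graph_distP x.
by move=> l0; move: sp lp; rewrite l0 => /size0nil -> /= ->.
Qed.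

Lemma lev_adj x y : adj x y -> (lev y <= (lev x).+1)%N.
Proof.
move=> xy; have [[p [pp lp sp]] _] := graph_distP x.
have [_ h] := graph_distP y; apply: h; exists (rcons p y).
by rewrite rcons_path pp lp xy last_rcons size_rcons sp.
Qed.

Lemma lev_pred x n : lev x = n.+1 -> exists2 y, adj x y & lev y = n.
Proof.
move=> lx; have [[p [pp lp sp]] _] := graph_distP x.
move: sp pp lp; rewrite lx; case/lastP: p => // p z.
rewrite size_rcons rcons_path last_rcons => -[sp] /andP[pp az] zx.
move: az; rewrite {}zx adjC => xy; exists (last e p) => //.
apply/eqP; rewrite eqn_leq; have [_ h] := graph_distP (last e p).
rewrite h; last by exists p.
by rewrite -ltnS -lx lev_adj // adjC.
Qed.

(* A geodesic from the root to z will do. *)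
Lemma path_avoiding x z : (lev z <= lev x)%N -> z != x ->
  exists p, [/\ path adj e p, last e p = z & x \notin e :: p].
Proof.
move En : (lev z) => n; elim: n z En => [|n IH] z En zx nzx.
  exists [::]; split=> //=; first by rewrite (lev_eq0 En).
  by rewrite inE -(lev_eq0 En) eq_sym.
have [y zy ly] := lev_pred En.
have yx : y != x by apply: contraTneq zx => <-; rewrite ly ltnn.
have [p [pp lp xp]] := IH y ly (ltnW zx) yx.
exists (rcons p z); rewrite rcons_path pp lp last_rcons adjC zy.
by rewrite -rcons_cons mem_rcons inE negb_or eq_sym nzx.
Qed.

(** By [path_avoiding], [y] and [z] are both joined to the root by paths missing [x]. Gluing these
    and removing repetitions yields a simple path from [y] to [z], which [x] closes to a cycle of
    size at least 3 unless [y = z]. *)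
Lemma lower_neighbour_unique x y z : adj x y -> adj x z ->
  (lev y <= lev x)%N -> (lev z <= lev x)%N -> y = z.
Proof.
move=> xy xz ly lz; apply/eqP/negP => /negP nyz.
have nyx : y != x by apply: contraTneq xy => ->; rewrite adjI.
have nzx : z != x by apply: contraTneq xz => ->; rewrite adjI.
have [p [pp lp xp]] := path_avoiding ly nyx.
have [p' [pp' lp' xp']] := path_avoiding lz nzx.
have [r [pr lr xr]] : exists r, [/\ path adj y r, last y r = z & x \notin y :: r].
  (* Back from [y] to the root along [p], then on to [z] along [p']. *)
  exists (rev (belast e p) ++ p'); split.
  - rewrite cat_path -{1}lp rev_path.
    rewrite (eq_path (e' := adj)) ?pp; last by move=> a b; rewrite /= adjC.
    suff -> : last y (rev (belast e p)) = e by [].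
    case: p lp {pp xp} => [|a p] /= lp; first by rewrite lp.
    by rewrite rev_cons last_rcons.
  - rewrite last_cat; suff -> : last y (rev (belast e p)) = e by [].
    case: p lp {pp xp} => [|a p] /= lp; first by rewrite lp.
    by rewrite rev_cons last_rcons.
  - rewrite inE mem_cat !negb_or eq_sym nyx mem_rev /=.
    move: xp; rewrite lastI mem_rcons inE negb_or => /andP[_ ->] /=.
    by move: xp'; rewrite inE negb_or => /andP[].
case/shortenP: pr lr xr => r' pr' ur' sr' lr' xr.
have [_ _ acyc _] := hT.
have : ucycle adj (x :: y :: r').
  apply/andP; split; last first.
    rewrite cons_uniq ur' andbT; apply: contra xr; rewrite !inE.
    by case/orP=> [->//|/sr' ->]; rewrite orbT.
  by rewrite /= xy rcons_path pr' lr' adjC xz.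
move/acyc; case: r' lr' {pr' ur' sr'} => //= yz _.
by rewrite yz eqxx in nyz.
Qed.

Definition nbrs x : seq T := fset_set (neighbours adj x).

Lemma neighbours_finite x : finite_set (neighbours adj x).
Proof. by have [_ _ _ h] := hT; exists q. Qed.

Lemma mem_nbrs x y : (y \in nbrs x) = adj x y.
Proof.
rewrite /nbrs in_fset_set; last exact: neighbours_finite.
by apply/idP/idP; rewrite in_setE.
Qed.

Lemma nbrs_uniq x : uniq (nbrs x). Proof. exact: fset_uniq. Qed.

Lemma size_nbrs x : size (nbrs x) = q.
Proof.
by have [_ _ _ h] := hT; exact: card_fset_set.
Qed.

Definition children x := [seq y <- nbrs x | (lev x < lev y)%N].

Lemma mem_children x y : (y \in children x) = adj x y && (lev y == (lev x).+1).
Proof.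
rewrite mem_filter mem_nbrs andbC; case: (boolP (adj x y)) => //= xy.
by rewrite eqn_leq lev_adj.
Qed.

(** Existence comes from a geodesic, uniqueness from acyclicity. As equality of levels is allowed in
    [lower_neighbour_unique], no neighbour lies on the level of [x] itself. *)
Lemma lower_nbrs x : lev x != 0%N -> exists2 y, adj x y /\ (lev y).+1 = lev x &
  [seq y <- nbrs x | ~~ (lev x < lev y)%N] = [:: y].
Proof.
case En : (lev x) => [//|n] _; have [y xy ly] := lev_pred En.
exists y; first by rewrite ly.
apply: perm_small_eq => //; apply: uniq_perm => //; first by rewrite filter_uniq ?nbrs_uniq.
move=> z; rewrite mem_filter mem_nbrs inE -leqNgt -En; apply/andP/eqP => [[lz xz]|->].
  by apply: lower_neighbour_unique xz xy lz _; rewrite ly En.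
by rewrite ly En.
Qed.

Lemma size_children x : size (children x) = (q - (lev x != 0))%N.
Proof.
have := count_predC (fun y => lev x < lev y)%N (nbrs x).
rewrite -!size_filter size_nbrs -/(children x).
have [lx|lx] := eqVneq (lev x) 0%N.
  rewrite subn0 => <-; rewrite (eq_in_filter (a2 := pred0)) ?filter_pred0 ?addn0 //.
  move=> y; rewrite mem_nbrs /= -leqNgt lx leqn0 => ey; apply/negP => /eqP/lev_eq0 ye.
  by move: ey; rewrite ye (lev_eq0 lx) adjI.
by have [y _ ->] := lower_nbrs lx => <-; rewrite addnK.
Qed.

Fixpoint level l : seq T :=
  if l is k.+1 then flatten [seq children x | x <- level k] else [:: e].

Lemma mem_level l x : (x \in level l) = (lev x == l).
Proof.
elim: l x => [|l IH] x /=.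
  rewrite inE; apply/eqP/eqP => [->|/lev_eq0//]; exact: lev_root.
apply/flatten_mapP/eqP => [[y]|lx].
  by rewrite IH mem_children => /eqP <- /andP[_ /eqP].
have [y xy ly] := lev_pred lx; exists y; first by rewrite IH ly.
by rewrite mem_children adjC xy ly lx eqxx.
Qed.

Lemma level_uniq l : uniq (level l).
Proof.
elim: l => //= l; have : forall x, x \in level l -> lev x = l.
  by move=> x; rewrite mem_level => /eqP.
(* The induction runs over sublists of level [l]: two distinct vertices of one level have no child
   in common. *)
elim: (level l) => //= x s IH hs /andP[xs us].
rewrite cat_uniq filter_uniq ?nbrs_uniq //= IH // ?andbT; last first.
  by move=> y ys; apply: hs; rewrite inE ys orbT.
apply/hasPn => z /flatten_mapP[y ys]; rewrite !mem_children.
move=> /andP[yz /eqP lz]; apply/negP => /andP[xz _].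
have ly : lev y = l by apply: hs; rewrite inE ys orbT.
have lx : lev x = l by apply: hs; rewrite inE eqxx.
have : x = y by apply: (@lower_neighbour_unique z); rewrite 1?adjC // lz ?lx ?ly.
by move=> xy; rewrite xy ys in xs.
Qed.

Lemma size_level l : size (level l) = level_size q l.
Proof.
elim: l => // l IH /=.
rewrite size_flatten /shape -map_comp sumnE big_map.
rewrite (eq_big_seq (fun=> q - (l != 0))%N) => [|x]; last first.
  by rewrite mem_level /= size_children => /eqP ->.
rewrite big_const_seq count_predT iter_addn_0 IH.
by case: l {IH} => [|l]; rewrite /= ?subn0 ?muln1 // subn1 expnSr; ring.
Qed.

End Tree.

(** * Radial recursion for the walk killed at a level *)

(* [radial_mass q L t j] is the probability that the walk, not having visited
   level L before time t, is at time t at a given vertex of level j. *)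
Fixpoint radial_mass (R : realType) (q L t j : nat) : R :=
  if t is s.+1 then
    ((if j is i.+1 then if (i < L)%N then radial_mass R q L s i else 0 else 0) +
     (if (j.+1 < L)%N then (q - (j != 0))%:R * radial_mass R q L s j.+1 else 0))
    / q%:R
  else (j == 0)%:R.

Lemma radial_mass_ge0 (R : realType) q L t j : 0 <= radial_mass R q L t j.
Proof.
elim: t j => [|t IH] j /=; first exact: ler0n.
apply: divr_ge0; rewrite ?ler0n // addr_ge0 //; first by case: j => // j; case: ifP.
by case: ifP => // _; rewrite mulr_ge0 ?ler0n.
Qed.

Arguments level_size : simpl never.

Section RadialMass.
Variables (R : realType) (q L : nat).
Hypothesis hq : (3 <= q)%N.

Notation phi := (radial_mass R q L.+1).
Notation D := (level_size q).

Lemma level_sizeS j : D j.+1 = (D j * (q - (j != 0)))%N.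
Proof. by case: j => [|j]; rewrite /level_size ?subn0 ?muln1 ?mul1n // subn1 expnSr mulnA. Qed.

Lemma level_size_gt0 j : (0 < D j)%N.
Proof. by case: j => // j; rewrite /level_size muln_gt0 expn_gt0; lia. Qed.

(** One-step equation for the mean of [u] at the level of the killed walk: [phi] is a mass per
    vertex, so [D j * phi t j] is the mass of level [j]. Passing from sums over arrival levels to
    sums over departure levels rests on [level_sizeS], that is, on counting the edges between two
    levels from both ends. *)
Lemma sum_radial_massS (u : nat -> R) t :
  \sum_(j < L.+2) (D j)%:R * phi t.+1 j * u j =
  \sum_(j < L.+1) (D j)%:R * phi t j *
    (((q - (j != 0%N :> nat))%:R * u j.+1 + (j != 0%N :> nat)%:R * u j.-1) / q%:R).
Proof.
have q0 : q%:R != 0 :> R by rewrite pnatr_eq0; lia.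
(* Contributions of the parent ([up]) and of the children ([down]) to the mass at a vertex of level
   [j]. *)
pose up j := if j is i.+1 then if (i < L.+1)%N then phi t i else 0 else 0.
pose down j := if (j.+1 < L.+1)%N then (q - (j != 0%N))%:R * phi t j.+1 else 0.
transitivity (\sum_(j < L.+2) (D j)%:R * u j * up j / q%:R +
              \sum_(j < L.+2) (D j)%:R * u j * down j / q%:R).
  rewrite -big_split; apply: eq_bigr => j _ /=.
  by rewrite -mulrDl -mulrDr; move: (_ + _) => X; field.
have -> : \sum_(j < L.+2) (D j)%:R * u j * up j / q%:R =
    \sum_(j < L.+1) (D j)%:R * phi t j *
      ((q - (j != 0%N :> nat))%:R * u j.+1 / q%:R).
  rewrite big_ord_recl mulr0 mul0r add0r; apply: eq_bigr => i _.
  by rewrite lift0 /up ltn_ord level_sizeS natrM; field.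
have -> : \sum_(j < L.+2) (D j)%:R * u j * down j / q%:R =
    \sum_(j < L.+1) (D j)%:R * phi t j * ((j != 0%N :> nat)%:R * u j.-1 / q%:R).
  rewrite -(big_mkord xpredT (fun j => (D j)%:R * u j * down j / q%:R)).
  rewrite 2?big_nat_recr //= /down ltnn ltnNge ltnW // !mulr0 !mul0r !addr0 big_mkord.
  rewrite [RHS]big_ord_recl !mul0r mulr0 add0r; apply: eq_bigr => i _.
  by rewrite lift0 /= ltnS ltn_ord level_sizeS natrM; field.
by rewrite -big_split; apply: eq_bigr => j _; rewrite mulrDl mulrDr.
Qed.

(** Mass still below level [L.+1] at time [t], mass absorbed there exactly at time [t], and first
    moment of the level over the surviving mass. *)
Let alive t : R := \sum_(j < L.+1) (D j)%:R * phi t j.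
Let arrived t : R := (D L.+1)%:R * phi t L.+1.
Let height t : R := \sum_(j < L.+1) (D j)%:R * phi t j * (j : nat)%:R.

Let aliveS t : alive t.+1 + arrived t.+1 = alive t.
Proof.
have := sum_radial_massS (fun=> 1) t; rewrite big_ord_recr /= mulr1 => h.
transitivity (\sum_(i < L.+1) (D i)%:R * phi t.+1 i * 1 + arrived t.+1).
  by congr +%R; apply: eq_bigr => i _; rewrite mulr1.
rewrite h; apply: eq_bigr => j _; rewrite !mulr1 -natrD subnK; last by case: eqP; lia.
by rewrite divff ?mulr1 // pnatr_eq0; lia.
Qed.

Let alive_arrived t : alive t + \sum_(1 <= i < t.+1) arrived i = 1.
Proof.
elim: t => [|t IH].
  rewrite big_geq // addr0 /alive big_ord_recl /= big1 ?addr0 ?mulr1 // => i _.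
  by rewrite mulr0.
by rewrite -[RHS]IH big_nat_recr //= -(aliveS t) addrA addrAC.
Qed.

(* The walk drifts away from the root at speed at least 1/q. *)
Let heightS t : height t + alive t / q%:R <= height t.+1 + L.+1%:R * arrived t.+1.
Proof.
have q0 : 0 < q%:R :> R by rewrite ltr0n; lia.
have := sum_radial_massS (fun j => j%:R) t; rewrite big_ord_recr /= [_ * L.+1%:R]mulrC => ->.
rewrite /height /alive mulr_suml -big_split; apply: ler_sum => j _ /=.
rewrite -mulrDr ler_wpM2l //; first by rewrite mulr_ge0 ?ler0n ?radial_mass_ge0.
rewrite ler_pdivlMr // mulrDl mulVf ?lt0r_neq0 //.
by rewrite -!natrM -!natrD natr1 ler_nat; case: (nat_of_ord j) => [|i] /=; nia.
Qed.

Let height_le t : height t <= L.+1%:R * alive t.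
Proof.
rewrite mulr_sumr; apply: ler_sum => j _; rewrite mulrC.
by rewrite ler_wpM2r ?mulr_ge0 ?ler0n ?radial_mass_ge0 // ler_nat ltnW.
Qed.

(** Sum of [heightS] over time: the total drift is paid for by the present height and by the height
    of the absorbed mass. *)
Let sum_alive t : \sum_(0 <= i < t) alive i / q%:R <=
  height t + L.+1%:R * \sum_(1 <= i < t.+1) arrived i.
Proof.
elim: t => [|t IH].
  by rewrite !big_geq // mulr0 addr0 sumr_ge0 // => j _; rewrite !mulr_ge0 ?ler0n ?radial_mass_ge0.
rewrite big_nat_recr // [X in _ <= _ + _ * X]big_nat_recr //=.
have := heightS t; rewrite mulrDr => hS; lra.
Qed.

Lemma arrival_mass : exists K,
  1 <= 2 * \sum_(t < K) (D L.+1)%:R * radial_mass R q L.+1 t L.+1.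
Proof.
(* The total drift is at most [L.+1] and [alive] decreases, so [K * alive K / q <= L.+1]. This [K]
   makes [alive K] at most 1/2, and the other half has been absorbed by time [K]. *)
pose K := (2 * q * L.+1)%N; exists K.+1.
have decr k i : (i <= k)%N -> alive k <= alive i.
  elim: k => [|k IH]; first by rewrite leqn0 => /eqP ->.
  rewrite leq_eqVlt => /predU1P[->//|ik]; apply: le_trans (IH ik).
  by rewrite -(aliveS k) lerDl mulr_ge0 ?ler0n ?radial_mass_ge0.
have q0 : 0 < q%:R :> R by rewrite ltr0n; lia.
have h1 : alive K * K%:R / q%:R <= L.+1%:R.
  apply: le_trans (_ : \sum_(0 <= i < K) alive i / q%:R <= _).
    rewrite -mulr_suml ler_pM2r ?invr_gt0 // mulr_natr.
    rewrite -[X in _ *+ X]subn0 -sumr_const_nat; rewrite !big_nat; apply: ler_sum => i.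
    by move=> /andP[_ /ltnW]; exact: decr.
  apply: le_trans (sum_alive K) _.
  have tot := congr1 (fun x => L.+1%:R * x) (alive_arrived K).
  by rewrite /= mulrDr mulr1 in tot; rewrite -[leRHS]tot lerD2r height_le.
have h2 : 2 * alive K <= 1.
  have L0 : 0 < L.+1%:R :> R by rewrite ltr0n.
  rewrite -(ler_pM2r L0) mul1r; apply: le_trans h1.
  by rewrite /K !natrM le_eqVlt; apply/orP; left; apply/eqP; field; rewrite lt0r_neq0.
have := alive_arrived K; rewrite -(big_mkord xpredT arrived) big_ltn // /arrived.
have := radial_mass_ge0 R q L.+1 0 L.+1; rewrite /= mulr0 add0r; lra.
Qed.

End RadialMass.

(** * Second moment method *)

Section Probability.
Variables (R : realType) (d : measure_display) (Omega : measurableType d).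
Variable P : probability Omega R.

Definition pr (A : set Omega) : R := fine (P A).

Lemma prE A : measurable A -> P A = (pr A)%:E.
Proof. by move=> mA; rewrite fineK // fin_num_measure. Qed.

Lemma pr_ge0 A : 0 <= pr A. Proof. exact: fine_ge0. Qed.

Lemma pr_set0 : pr set0 = 0. Proof. by rewrite /pr measure0. Qed.

Lemma pr_setT : pr setT = 1. Proof. by rewrite /pr probability_setT. Qed.

Lemma le_pr A B : measurable A -> measurable B -> A `<=` B -> pr A <= pr B.
Proof. by move=> mA mB AB; rewrite -lee_fin -!prE // le_measure ?inE. Qed.

Lemma pr_le1 A : measurable A -> pr A <= 1.
Proof. by move=> mA; rewrite -pr_setT; exact: le_pr. Qed.

Lemma pr_split A B : measurable A -> measurable B ->
  pr A = pr (A `\` B) + pr (A `&` B).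
Proof.
move=> mA mB; apply: EFin_inj; rewrite EFinD -!prE //.
- exact: measureDI.
- exact: measurableI.
- exact: measurableD.
Qed.

Lemma pr_setC A : measurable A -> pr (~` A) = 1 - pr A.
Proof. by move=> mA; rewrite -pr_setT (pr_split measurableT mA) setTD setTI addrK. Qed.

Lemma pr_setU_le A B : measurable A -> measurable B -> pr (A `|` B) <= pr A + pr B.
Proof.
move=> mA mB; rewrite (pr_split (measurableU _ _ mA mB) mA) addrC; apply: lerD.
  by apply: le_pr => //; apply: measurableI => //; exact: measurableU.
apply: le_pr => //; first by apply: measurableD => //; exact: measurableU.
by move=> w [[]].
Qed.

Lemma sum_disjoint_pr_le (I : eqType) (s : seq I) (F : I -> set Omega) A :
  uniq s -> measurable A -> (forall i, i \in s -> measurable (F i)) ->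
  (forall i j w, i \in s -> j \in s -> F i w -> F j w -> i = j) ->
  (forall i, i \in s -> F i `<=` A) -> \sum_(i <- s) pr (F i) <= pr A.
Proof.
elim: s A => [|i s IH] A; first by rewrite big_nil pr_ge0.
move=> /= /andP[is_ us] mA mF disj sub; rewrite big_cons.
have mFi : measurable (F i) by apply: mF; rewrite inE eqxx.
rewrite (pr_split mA mFi) addrC; apply: lerD; last first.
  apply: le_pr => //; first exact: measurableI.
  by move=> w Fw; split=> //; apply: sub Fw; rewrite inE eqxx.
apply: IH => //; first exact: measurableD.
- by move=> j js; apply: mF; rewrite inE js orbT.
- by move=> j k w js ks; apply: disj; rewrite inE ?js ?ks orbT.
- move=> j js w Fj; split; first by apply: sub Fj; rewrite inE js orbT.
  move=> Fi; move: is_; rewrite (disj i j w) ?js //; rewrite inE ?eqxx ?js ?orbT //.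
Qed.

Lemma pr_le_sum (I : eqType) (s : seq I) (F : I -> set Omega) A :
  measurable A -> (forall i, i \in s -> measurable (F i)) ->
  (forall w, A w -> exists2 i, i \in s & F i w) -> pr A <= \sum_(i <- s) pr (F i).
Proof.
elim: s A => [|i s IH] A mA mF cov.
  rewrite big_nil (_ : A = set0) ?pr_set0 //.
  by rewrite -subset0 => w /cov[].
have mFi : measurable (F i) by apply: mF; rewrite inE eqxx.
rewrite big_cons (pr_split mA mFi) addrC; apply: lerD.
  by apply: le_pr => //; exact: measurableI.
apply: IH; first exact: measurableD.
  by move=> j js; apply: mF; rewrite inE js orbT.
move=> w [/cov[j]]; rewrite inE => /predU1P[->//|js] Fj _; by exists j.
Qed.

(** Expectation of a simple function, read off a presentation as a finite combination of indicators.
    The sets may overlap and the coefficients may be negative, so a square can be expanded term by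
    term. *)
Definition has_mean (f : Omega -> R) (x : R) : Prop :=
  exists s : seq (R * set Omega),
    [/\ forall a, a \in map snd s -> measurable a,
        forall w, f w = \sum_(a <- s) a.1 * \1_(a.2) w &
        x = \sum_(a <- s) a.1 * pr a.2].

Lemma has_mean_indic (c : R) A : measurable A ->
  has_mean (fun w => c * \1_A w) (c * pr A).
Proof.
move=> mA; exists [:: (c, A)]; split=> [a|w|]; rewrite ?big_seq1 //.
by rewrite /= inE => /eqP ->.
Qed.

Lemma has_mean_cst c : has_mean (fun=> c) c.
Proof.
have [s [ms hs xs]] := has_mean_indic c measurableT; exists s; split=> // [w|].
  by rewrite -hs indicT mulr1.
by rewrite -xs pr_setT mulr1.
Qed.

Lemma has_meanD f g x y : has_mean f x -> has_mean g y ->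
  has_mean (fun w => f w + g w) (x + y).
Proof.
move=> [s [ms hs xs]] [t [mt ht yt]]; exists (s ++ t); split=> [a|w|].
- by rewrite map_cat mem_cat => /orP[/ms|/mt].
- by rewrite big_cat /= hs ht.
- by rewrite big_cat /= xs yt.
Qed.

Lemma has_mean_sum (I : Type) (s : seq I) (f : I -> Omega -> R) (x : I -> R) :
  (forall i, has_mean (f i) (x i)) ->
  has_mean (fun w => \sum_(i <- s) f i w) (\sum_(i <- s) x i).
Proof.
move=> h; elim: s => [|i s IH].
  rewrite big_nil (_ : (fun w => _) = fun=> 0); first exact: has_mean_cst.
  by apply: funext => w; rewrite big_nil.
rewrite big_cons (_ : (fun w => _) = fun w => f i w + \sum_(i <- s) f i w); first exact: has_meanD.
by apply: funext => w; rewrite big_cons.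
Qed.

Lemma has_mean_ge0 f x : has_mean f x -> (forall w, 0 <= f w) -> 0 <= x.
Proof.
move=> [s [ms hs ->]] f0.
(* Generalisation for the induction: on the part [B], the sets already treated contribute the
   constant [c]. Each new set splits [B] in two and raises [c] on one half. *)
suff h B c : measurable B -> (forall w, B w -> 0 <= c + \sum_(a <- s) a.1 * \1_(a.2) w) ->
    0 <= c * pr B + \sum_(a <- s) a.1 * pr (B `&` a.2).
  have := h setT 0 measurableT; rewrite mul0r add0r; under eq_bigr do rewrite setTI.
  by apply=> w _; rewrite add0r -hs.
elim: s ms B c {hs} => [|[a A] s IH] ms B c mB.
  rewrite big_nil addr0 => h; have [->|/set0P[w Bw]] := eqVneq B set0.
    by rewrite pr_set0 mulr0.
  by rewrite mulr_ge0 ?pr_ge0 //; have := h w Bw; rewrite big_nil addr0.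
have mA : measurable A by apply: (ms A); rewrite /= inE eqxx.
have {}ms X : X \in map snd s -> measurable X by move=> Xs; apply: ms; rewrite /= inE Xs orbT.
move=> h; rewrite big_cons /= (pr_split mB mA).
have h1 : 0 <= (c + a) * pr (B `&` A) + \sum_(x <- s) x.1 * pr ((B `&` A) `&` x.2).
  apply: IH => //; first exact: measurableI.
  by move=> w [Bw Aw]; have := h w Bw; rewrite big_cons /= indicE mem_set // mulr1 addrA.
have h2 : 0 <= c * pr (B `\` A) + \sum_(x <- s) x.1 * pr ((B `\` A) `&` x.2).
  apply: IH => //; first exact: measurableD.
  by move=> w [Bw Aw]; have := h w Bw; rewrite big_cons /= indicE memNset // mulr0 add0r.
have -> : \sum_(x <- s) x.1 * pr (B `&` x.2) = \sum_(x <- s) x.1 * pr ((B `&` A) `&` x.2) +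
   \sum_(x <- s) x.1 * pr ((B `\` A) `&` x.2).
  rewrite -big_split /= !big_seq; apply: eq_bigr => -[b X] xs /=.
  have mX : measurable X by apply: ms; apply/mapP; exists (b, X).
  rewrite -mulrDr [in LHS](@pr_split _ A) //; last exact: measurableI.
  rewrite addrC; congr (_ * (pr _ + pr _)); first by rewrite setIAC.
  by rewrite !setDE setIAC.
by have := addr_ge0 h1 h2; rewrite mulrDl mulrDr; lra.
Qed.

(* Chebyshev's inequality for the number of the events F i which occur. *)
Lemma second_moment (I : eqType) (s : seq I) (F : I -> set Omega) N :
  uniq s -> measurable N -> (forall i, measurable (F i)) ->
  (forall i w, i \in s -> N w -> ~ F i w) ->
  (forall i j, i \in s -> j \in s -> i != j -> pr (F i `&` F j) <= pr (F i) * pr (F j)) ->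
  pr N * \sum_(i <- s) pr (F i) <= 1.
Proof.
move=> us mN mF NF cov; set mu := \sum_(i <- s) _.
have mu0 : 0 <= mu by apply: sumr_ge0 => i _; exact: pr_ge0.
(* With Z the number of events that occur, this is the mean of the function equal to [(Z - mu) ^+ 2]
   off [N] and to 0 on [N], where Z vanishes. It gives [mu ^+ 2 * pr N] at most the variance of
   Z. *)
have h : 0 <= \sum_(i <- s) \sum_(j <- s) 1 * pr (F i `&` F j) +
   (\sum_(i <- s) (- (2 * mu)) * pr (F i) + (mu ^+ 2 + (- mu ^+ 2) * pr N)).
  apply: (@has_mean_ge0 (fun w => \sum_(i <- s) \sum_(j <- s) 1 * \1_(F i `&` F j) w +
   (\sum_(i <- s) (- (2 * mu)) * \1_(F i) w + (mu ^+ 2 + (- mu ^+ 2) * \1_N w)))).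
    apply: has_meanD; first by apply: has_mean_sum => i; apply: has_mean_sum => j;
      apply: has_mean_indic; exact: measurableI.
    apply: has_meanD; first by apply: has_mean_sum => i; exact: has_mean_indic.
    by apply: has_meanD; [exact: has_mean_cst|exact: has_mean_indic].
  move=> w; have -> : \sum_(i <- s) \sum_(j <- s) 1 * \1_(F i `&` F j) w =
      (\sum_(i <- s) \1_(F i) w) ^+ 2 :> R.
    rewrite expr2 big_distrlr /=; apply: eq_bigr => i _; apply: eq_bigr => j _.
    by rewrite mul1r indicI.
  rewrite -mulr_sumr; have [Nw|Nw] := pselect (N w).
    rewrite (_ : \sum_(i <- s) \1_(F i) w = 0) ?indicE ?mem_set //.
      by rewrite expr0n /= mulr0 mulr1 subrr !addr0.
    by rewrite big_seq big1 // => i /NF h; rewrite indicE memNset //; exact: h.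
  rewrite indicE memNset // mulr0 addr0; move: (\sum_(i <- s) _) => z.
  by rewrite (_ : _ + _ = (z - mu) ^+ 2) ?sqr_ge0 //; ring.
(* The diagonal contributes [mu]; the off-diagonal terms are bounded by negative correlation. *)
have h2 : \sum_(i <- s) \sum_(j <- s) 1 * pr (F i `&` F j) <= mu + mu ^+ 2.
  have -> : mu + mu ^+ 2 = \sum_(i <- s) (pr (F i) + \sum_(j <- s) pr (F i) * pr (F j)).
    by rewrite big_split /= expr2 -big_distrlr.
  rewrite !big_seq; apply: ler_sum => i is_.
  rewrite !(bigD1_seq i) //= mul1r setIid lerD2l.
  rewrite ler_wpDl ?mulr_ge0 ?pr_ge0 // big_seq_cond [leRHS]big_seq_cond.
  apply: ler_sum => j /andP[js ji].
  by rewrite mul1r cov // eq_sym.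
move: h; rewrite -mulr_sumr -/mu => h; have [->|mu1] := eqVneq mu 0; first by rewrite mulr0 ler01.
have {}mu0 : 0 < mu by rewrite lt0r mu1.
by rewrite -(ler_pM2l mu0); nra.
Qed.

End Probability.

(** * Hitting a level *)

Section ProcessSigma.
Variables (Omega : Type) (T : countType) (X : nat -> Omega -> T).

Notation sigmaX := (process_sigma X).

Let sigmaX_algebra : sigma_algebra setT sigmaX.
Proof. exact: smallest_sigma_algebra. Qed.

Lemma process_sigma_setC E : sigmaX E -> sigmaX (~` E).
Proof. by case: sigmaX_algebra => _ h _ /h; rewrite setTD. Qed.

Lemma process_sigma_exists (F : nat -> Omega -> Prop) :
  (forall i, sigmaX [set w | F i w]) -> sigmaX [set w | exists i, F i w].
Proof.
case: sigmaX_algebra => _ _ h /h; rewrite (_ : \bigcup_k _ = [set w | exists i, F i w]) //.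
by apply/seteqP; split=> [w [i _ Fi]|w [i Fi]]; exists i.
Qed.

Lemma process_sigma_forall (F : nat -> Omega -> Prop) :
  (forall i, sigmaX [set w | F i w]) -> sigmaX [set w | forall i, F i w].
Proof.
move=> h; rewrite (_ : mkset _ = ~` [set w | exists i, ~ F i w]).
  by apply: process_sigma_setC; apply: process_sigma_exists => i; exact: (process_sigma_setC (h i)).
apply/seteqP; split=> [w Fw [i]|w nF i]; first by apply; exact: Fw.
by apply: contrapT => nFi; apply: nF; exists i.
Qed.

Lemma process_sigma_setT : sigmaX setT.
Proof. by rewrite -setC0; apply: process_sigma_setC; case: sigmaX_algebra. Qed.

Lemma process_sigma_imply (b : bool) (Q : set Omega) :
  sigmaX Q -> sigmaX [set w | b -> Q w].
Proof.
case: b => sQ.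
  by rewrite (_ : mkset _ = Q) //; apply/seteqP; split=> [w h|w Qw _]; [exact: h|].
by rewrite (_ : mkset _ = setT); [exact: process_sigma_setT|apply/seteqP; split].
Qed.

Lemma process_sigma_setI E F : sigmaX E -> sigmaX F -> sigmaX (E `&` F).
Proof.
move=> sE sF; rewrite (_ : _ `&` _ = [set w | forall i, (if i is 0%N then E else F) w]).
  by apply: process_sigma_forall => -[|i].
apply/seteqP; split=> [w [Ew Fw] []//|w h]; split; [exact: (h 0%N)|exact: (h 1%N)].
Qed.

(** As [T] is countable, the preimage is a countable union of preimages of points, indexed here by
    the codes of the points. *)
Lemma process_sigma_preimage k (A : set T) : sigmaX (X k @^-1` A).
Proof.
have sx x : sigmaX (X k @^-1` [set x]).
  by apply: sub_gen_smallest; exists k, x.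
rewrite (_ : _ @^-1` _ = [set w | exists i : nat,
    if (choice.unpickle i : option T) is Some x then A x /\ X k w = x else False]).
  apply: process_sigma_exists => i; case: (choice.unpickle i) => [x|]; last first.
    by rewrite -[X in sigmaX X]/set0; case: sigmaX_algebra.
  have [Ax|Ax] := pselect (A x).
    by rewrite (_ : mkset _ = X k @^-1` [set x]) //; apply/seteqP; split=> w // -[].
  rewrite (_ : mkset _ = set0); first by case: sigmaX_algebra.
  by apply/seteqP; split=> w // -[].
apply/seteqP; split=> [w Aw|w [i]] /=.
  by exists (choice.pickle (X k w)); rewrite choice.pickleK.
by case: (choice.unpickle i) => // x [Ax ->].
Qed.

End ProcessSigma.

(** * Probability that a walk first meets a level at a given vertex *)

Section Walk.
Variables (R : realType) (T : countType) (adj : rel T) (q : nat).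
Hypotheses (hq : (3 <= q)%N) (hT : homogeneous_tree adj q).
Variables (e : T) (d : measure_display) (Omega : measurableType d).
Variables (P : probability Omega R) (X : nat -> Omega -> T).
Hypothesis hX : simple_random_walk P adj e X.

Notation lev := (graph_dist adj e).

Lemma process_sigma_measurable E : process_sigma X E -> measurable E.
Proof.
apply: smallest_sub; first exact: sigma_algebra_measurable.
by move=> A [k [x ->]]; case: hX.
Qed.

(** The case [i = 0] of the second clause puts the walk at [x] at time [t]. The level of [x] is left
    free, which lets [hits_at_ge] descend to vertices below level [L]. *)
Definition hits_at L (p : seq T) x t : set Omega :=
  [set w | (forall j, (j < t)%N -> (lev (X j w) < L)%N) /\
           (forall i, (i <= size p)%N -> X (t + i)%N w = nth x (x :: p) i)].

(* For x of level L: the first vertex of level L visited by the walk is x, and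
   the walk then follows the path p without turning back. *)
Definition hits L p x : set Omega := [set w | exists t, hits_at L p x t w].

Lemma process_sigma_hits_at L p x t : process_sigma X (hits_at L p x t).
Proof.
apply: process_sigma_setI; apply: process_sigma_forall => i; apply: process_sigma_imply.
  exact: (process_sigma_preimage i [set z | (lev z < L)%N]).
exact: (process_sigma_preimage (t + i) [set nth x (x :: p) i]).
Qed.

Lemma process_sigma_hits L p x : process_sigma X (hits L p x).
Proof. by apply: process_sigma_exists => t; exact: process_sigma_hits_at. Qed.

Lemma measurable_hits_at L p x t : measurable (hits_at L p x t).
Proof. by apply: process_sigma_measurable; exact: process_sigma_hits_at. Qed.

Lemma measurable_hits L p x : measurable (hits L p x).
Proof. by apply: process_sigma_measurable; exact: process_sigma_hits. Qed.

Lemma pr_cylinder k (x : nat -> T) : x 0%N = e ->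
  (forall j, (j < k)%N -> adj (x j) (x j.+1)) ->
  P (\bigcap_(j < k.+1) (X j @^-1` [set x j])) = ((q%:R^-1) ^+ k)%:E.
Proof.
have [_ X0 step] := hX => x0; elim: k => [|k IH] hadj.
  rewrite (_ : \bigcap_(j < 1) _ = X 0%N @^-1` [set e]) ?X0 //.
  apply/seteqP; split=> [w /(_ 0%N)|w Xw j]; first by rewrite /= x0; apply.
  by rewrite /= ltnS leqn0 => /eqP ->; rewrite x0.
rewrite step IH => [|j jk]; last by apply: hadj; exact: ltnW.
by rewrite /srw_step hadj // -/(nbrs adj _) (size_nbrs hT) -EFinM exprSr.
Qed.

(** Induction on [t] moves the last step before [x] into the prescribed path: reaching [x] through a
    neighbour [y] below [L] is reaching [y] one step earlier and then following [x :: p]. At [t = 0]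
    only a cylinder remains, so the Markov property is used on cylinders alone. *)
Lemma hits_at_ge L t x p : path adj x p ->
  radial_mass R q L t (lev x) * (q%:R^-1) ^+ size p <= pr P (hits_at L p x t).
Proof.
have q0 : 0 < q%:R :> R by rewrite ltr0n; lia.
elim: t x p => [|t IH] x p xp.
  rewrite /=; have [lx|lx] := eqVneq (lev x) 0%N; last by rewrite mul0r pr_ge0.
  rewrite mul1r -lee_fin -prE; last exact: measurable_hits_at.
  rewrite -(@pr_cylinder _ (nth x (x :: p))) => [||j jp]; last first.
  - by move/pathP: xp => /(_ x); apply.
  - exact: (lev_eq0 hT lx).
  apply: le_measure; rewrite ?inE; last 1 first.
  - move=> w h; split=> // i ip; rewrite add0n; exact: h.
  - by apply: bigcap_measurable => [|k _]; [exists 0%N|case: hX].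
  - exact: measurable_hits_at.
have sub y : y \in [seq y <- nbrs adj x | (lev y < L)%N] ->
    hits_at L (x :: p) y t `<=` hits_at L p x t.+1.
  rewrite mem_filter (mem_nbrs hT) => /andP[yL xy] w [h1 h2]; split=> [j|i ip].
    rewrite ltnS leq_eqVlt => /predU1P[->|]; last exact: h1.
    by have := h2 0%N isT; rewrite addn0 => ->.
  rewrite addSnnS (h2 i.+1) //=; apply: set_nth_default => //.
apply: le_trans (sum_disjoint_pr_le P _ _ _ _ sub); last first.
- move=> y z w _ _ [_ /(_ 0%N isT)] + [_ /(_ 0%N isT)]; by rewrite addn0 => -> .
- by move=> *; exact: measurable_hits_at.
- exact: measurable_hits_at.
- by rewrite filter_uniq // nbrs_uniq.
apply: (@le_trans _ _ (\sum_(y <- nbrs adj x | (lev y < L)%N)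
    radial_mass R q L t (lev y) * q%:R^-1 ^+ (size p).+1)); last first.
  rewrite -big_filter !big_seq; apply: ler_sum => y.
  rewrite mem_filter (mem_nbrs hT) => /andP[_ xy]; apply: (IH y (x :: p)) => /=.
  by rewrite xp andbT; case: hT => -[-> _].
rewrite -mulr_suml exprS mulrA ler_wpM2r //.
rewrite /= ler_pM2r ?invr_gt0 //.
(* Children and parent of [x] give the two terms in the recursion of [radial_mass]. *)
pose G j := if (j < L)%N then radial_mass R q L t j else 0.
have G0 j : 0 <= G j by rewrite /G; case: ifP => // _; exact: radial_mass_ge0.
rewrite big_mkcond [leRHS](bigID (fun y => lev x < lev y)%N) addrC /=.
rewrite -!(big_filter _ (fun y => _ < _)%N) -!(big_filter _ (fun y => ~~ _)).
apply: lerD.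
  rewrite -/(children adj e x).
  rewrite (eq_big_seq (fun=> G (lev x).+1)) => [|y].
    rewrite big_const_seq count_predT (size_children hT) iter_addr_0 /G.
    by case: ifP => _; rewrite ?mul0rn // mulr_natl.
  by rewrite (mem_children hT) => /andP[_ /eqP ->].
have [lx|lx] := eqVneq (lev x) 0%N; first by rewrite lx sumr_ge0 // => y _; exact: G0.
have [y [_ ly] ->] := lower_nbrs hT lx.
by rewrite big_seq1 -ly.
Qed.


Lemma hits_at_inj L p p' x x' t t' w : lev x = L -> lev x' = L ->
  hits_at L p x t w -> hits_at L p' x' t' w -> t = t' /\ x = x'.
Proof.
move=> lx lx' [h1 /(_ 0%N isT)] + [h1' /(_ 0%N isT)]; rewrite !addn0 /= => h2 h2'.
have tt' : t = t'.
  case: (ltngtP t t') => // lt.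
    by have := h1' t lt; rewrite h2 lx ltnn.
  by have := h1 t' lt; rewrite h2' lx' ltnn.
by split=> //; rewrite -h2 -h2' tt'.
Qed.

Lemma hits_inj L p p' x x' w : lev x = L -> lev x' = L ->
  hits L p x w -> hits L p' x' w -> x = x'.
Proof. by move=> lx lx' [t h] [t' h']; case: (hits_at_inj lx lx' h h'). Qed.

(** The events [hits_at] for different times are disjoint, and their masses add up by
    [arrival_mass]; its factor 2 is the one in the bound. *)
Lemma hits_ge L p x : lev x = L.+1 -> path adj x p ->
  (q%:R^-1) ^+ size p / (2 * (level_size q L.+1)%:R) <= pr P (hits L.+1 p x).
Proof.
move=> lx xp; have [K hK] := arrival_mass R L hq.
have D0 : 0 < (level_size q L.+1)%:R :> R by rewrite ltr0n level_size_gt0.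
apply: (@le_trans _ _ (\sum_(t <- iota 0 K) pr P (hits_at L.+1 p x t))); last first.
  apply: sum_disjoint_pr_le; first exact: iota_uniq.
  - exact: measurable_hits.
  - by move=> t _; exact: measurable_hits_at.
  - by move=> t t' w _ _ h h'; case: (hits_at_inj lx lx h h').
  - by move=> t _ w h; exists t.
apply: (@le_trans _ _ (\sum_(t <- iota 0 K)
    radial_mass R q L.+1 t L.+1 * (q%:R^-1) ^+ size p)); last first.
  by apply: ler_sum => t _; rewrite -{2}lx; exact: hits_at_ge.
rewrite -mulr_suml [leRHS]mulrC ler_wpM2l ?exprn_ge0 ?invr_ge0 ?ler0n //.
rewrite -[_^-1]mul1r ler_pdivrMr ?mulr_gt0 // mulrC -mulrA.
by rewrite -[K in iota 0 K]subn0 -/(index_iota 0 K) big_mkord mulr_sumr.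
Qed.

End Walk.

(** * Independence *)

Section Independence.
Variables (R : realType) (T : countType).
Variables (d : measure_display) (Omega : measurableType d).
Variables (P : probability Omega R) (S : nat -> nat -> Omega -> T).
Hypothesis mS : forall k E, (0 < k)%N -> process_sigma (S k) E -> measurable E.
Hypothesis hindep : independent_processes P S.

Notation pr := (pr P).

(** Independence of [W] from all walks of index above [t], in product form. Events about successive
    groups of walks can then be multiplied one group at a time. *)
Definition indep_after (t : nat) (W : set Omega) : Prop := measurable W /\
  forall (J : seq nat) (E : nat -> set Omega), uniq J ->
    (forall k, k \in J -> (t < k)%N) ->
    (forall k, k \in J -> process_sigma (S k) (E k)) ->
    pr (W `&` \bigcap_(k in [set` J]) E k) = pr W * \prod_(k <- J) pr (E k).

Lemma measurable_bigcap_process (t : nat) (J : seq nat) (E : nat -> set Omega) :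
  (forall k, k \in J -> (t < k)%N) ->
  (forall k, k \in J -> process_sigma (S k) (E k)) ->
  measurable (\bigcap_(k in [set` J]) E k).
Proof.
move=> Jt JE; apply: fin_bigcap_measurable => // k kJ; apply: (mS (k := k)).
  by apply: leq_trans (Jt k kJ).
exact: JE.
Qed.

Lemma indep_after_setT t : indep_after t setT.
Proof.
split=> // J E uJ Jt JE; rewrite setTI pr_setT mul1r /pr hindep //; last first.
  by move=> k /Jt; exact: leq_trans.
have mE k : k \in J -> measurable (E k).
  by move=> kJ; apply: (mS (k := k)); [exact: leq_trans (Jt k kJ)|exact: JE].
rewrite !big_seq (eq_bigr (fun k => (pr (E k))%:E)); first by rewrite prodEFin.
by move=> k /mE h; rewrite -prE.
Qed.

Lemma pr_setIC2 (X Q Q' : set Omega) : measurable X -> measurable Q -> measurable Q' ->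
  pr (X `&` (~` Q `&` ~` Q')) = pr X - pr (X `&` Q) - pr (X `&` Q') + pr (X `&` (Q `&` Q')).
Proof.
move=> mX mQ mQ'; rewrite setIA -setDE -setDE.
have e1 : (X `&` Q') `\` Q = (X `\` Q) `&` Q' by rewrite !setDE setIAC.
have e2 : (X `&` Q') `&` Q = X `&` (Q `&` Q') by rewrite -setIA [Q' `&` _]setIC.
have h1 := pr_split P mX mQ.
have h2 := pr_split P (measurableD mX mQ) mQ'.
have h3 := pr_split P (measurableI _ _ mX mQ') mQ.
rewrite e1 e2 in h3; rewrite h1 h3 h2.
by rewrite addrK opprD addrA addrK subrK.
Qed.

(** Inclusion-exclusion reduces the two complements to four intersections over [J], each of which
    factorises. In the applications [A k] and [B k] are failures of walk [k], so [W'] adds to [W]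
    that both targets are met by walks in [J]. *)
Lemma indep_after_step t t' W (J : seq nat) (A B : nat -> set Omega) :
  indep_after t W -> uniq J -> (forall k, k \in J -> (t < k <= t')%N) -> (t <= t')%N ->
  (forall k, k \in J -> process_sigma (S k) (A k)) ->
  (forall k, k \in J -> process_sigma (S k) (B k)) ->
  let W' := W `&` (~` (\bigcap_(k in [set` J]) A k) `&` ~` (\bigcap_(k in [set` J]) B k)) in
  indep_after t' W' /\
  pr W' = pr W * (1 - \prod_(k <- J) pr (A k) - \prod_(k <- J) pr (B k)
                  + \prod_(k <- J) pr (A k `&` B k)).
Proof.
move=> [mW iW] uJ Jt tt' JA JB W'.
have Jt1 k : k \in J -> (t < k)%N by move=> /Jt/andP[].
have mA := measurable_bigcap_process Jt1 JA.
have mB := measurable_bigcap_process Jt1 JB.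
have main I E : uniq I -> (forall k, k \in I -> (t' < k)%N) ->
    (forall k, k \in I -> process_sigma (S k) (E k)) ->
    pr (W' `&` \bigcap_(k in [set` I]) E k) = pr W *
    (1 - \prod_(k <- J) pr (A k) - \prod_(k <- J) pr (B k)
     + \prod_(k <- J) pr (A k `&` B k)) * \prod_(k <- I) pr (E k).
  move=> uI It IE; set G := \bigcap_(k in _) _.
  have It1 k : k \in I -> (t < k)%N by move=> /It; exact: leq_ltn_trans.
  have mG : measurable G by apply: (measurable_bigcap_process It1 IE).
  have JI : ~~ has (mem J) I.
    apply/hasPn => k /It tk; apply/negP => /Jt/andP[_]; by rewrite leqNgt tk.
  have ext C : (forall k, k \in J -> process_sigma (S k) (C k)) ->
      pr ((W `&` G) `&` \bigcap_(k in [set` J]) C k) =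
      pr W * \prod_(k <- J) pr (C k) * \prod_(k <- I) pr (E k).
    (* Merging both families over [J ++ I] lets the independence of [W] be used once. *)
    move=> JC; pose F k := if k \in J then C k else E k.
    have FI k : k \in I -> F k = E k.
      by move=> kI; rewrite /F ifN //; exact: (hasPn JI).
    have FJ k : k \in J -> F k = C k by rewrite /F => ->.
    have -> : (W `&` G) `&` \bigcap_(k in [set` J]) C k = W `&` \bigcap_(k in [set` J ++ I]) F k.
      apply/seteqP; split=> w.
        move=> [[Ww Gw] Cw]; split=> // k; rewrite /= mem_cat => /orP[kJ|kI].
          by rewrite FJ //; exact: Cw.
        by rewrite FI //; exact: Gw.
      move=> [Ww Fw]; split; first split=> // k kI.
        by rewrite -FI //; apply: Fw; rewrite /= mem_cat kI orbT.
      by move=> k kJ; rewrite -FJ //; apply: Fw; rewrite /= mem_cat kJ.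
    rewrite iW ?cat_uniq ?uJ ?uI ?JI //.
    - have EJ : \prod_(k <- J) pr (F k) = \prod_(k <- J) pr (C k).
        by apply: eq_big_seq => k kJ; rewrite FJ.
      have EI : \prod_(k <- I) pr (F k) = \prod_(k <- I) pr (E k).
        by apply: eq_big_seq => k kI; rewrite FI.
      by rewrite big_cat /= EJ EI mulrA.
    - by move=> k; rewrite mem_cat => /orP[/Jt1|/It1].
    - by move=> k; rewrite mem_cat => /orP[kJ|kI]; 
        [rewrite FJ //; exact: JC|rewrite FI //; exact: IE].
  have -> : W' `&` G = (W `&` G) `&`
      (~` (\bigcap_(k in [set` J]) A k) `&` ~` (\bigcap_(k in [set` J]) B k)).
    by rewrite /W' setIAC.
  rewrite pr_setIC2 //; last exact: measurableI.
  rewrite -bigcapI !ext //; last by move=> k kJ; apply: process_sigma_setI; [exact: JA|exact: JB].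
  by rewrite iW // -!mulrA -!mulrBr -!mulrDr; congr (_ * _); rewrite !mulrDl !mulNr mul1r.
have pW' : pr W' = pr W * (1 - \prod_(k <- J) pr (A k) - \prod_(k <- J) pr (B k)
                  + \prod_(k <- J) pr (A k `&` B k)).
  have := main [::] (fun=> setT) isT; rewrite big_nil mulr1 => <- //.
  by rewrite (_ : \bigcap_(k in _) _ = setT) ?setIT //; apply/seteqP; split.
split=> //; split; last by move=> I E uI It IE; rewrite main // pW'.
by apply: measurableI => //; apply: measurableI; exact: measurableC.
Qed.

Lemma pr_bigcap_process (J : seq nat) (E : nat -> set Omega) : uniq J ->
  (forall k, k \in J -> (0 < k)%N) -> (forall k, k \in J -> process_sigma (S k) (E k)) ->
  pr (\bigcap_(k in [set` J]) E k) = \prod_(k <- J) pr (E k).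
Proof.
move=> uJ J0 JE; have [_ h] := indep_after_setT 0.
by have := h J E uJ J0 JE; rewrite setTI pr_setT mul1r.
Qed.

End Independence.

(** * Blocks of walks *)

Section Blocks.
Variables (R : realType) (T : countType).
Variables (d : measure_display) (Omega : measurableType d).
Variables (P : probability Omega R) (S : nat -> nat -> Omega -> T).
Hypothesis mS : forall k E, (0 < k)%N -> process_sigma (S k) E -> measurable E.
Hypothesis hindep : independent_processes P S.

Notation pr := (pr P).

Definition occurs (J : seq nat) (E : nat -> set Omega) : set Omega :=
  [set w | exists2 k, k \in J & E k w].

Lemma occursC (J : seq nat) (E : nat -> set Omega) :
  occurs J E = ~` \bigcap_(k in [set` J]) ~` E k.
Proof.
apply/seteqP; split=> [w [k kJ Ek] /(_ k kJ)//|w nE].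
by apply: contrapT => h; apply: nE => k kJ Ek; apply: h; exists k.
Qed.

Lemma measurable_occurs (J : seq nat) (E : nat -> set Omega) :
  (forall k, k \in J -> (0 < k)%N) -> (forall k, k \in J -> process_sigma (S k) (E k)) ->
  measurable (occurs J E).
Proof.
move=> J0 JE; rewrite occursC; apply: measurableC.
by apply: (measurable_bigcap_process mS J0) => k kJ; apply: process_sigma_setC; exact: JE.
Qed.

(** Each factor satisfies [1 - x <= expR (- x)]. *)
Lemma prod_pr_setC_le (J : seq nat) (E : nat -> set Omega) y :
  (forall k, k \in J -> measurable (E k)) -> (forall k, k \in J -> y <= pr (E k)) ->
  \prod_(k <- J) pr (~` E k) <= expR (- ((size J)%:R * y)).
Proof.
elim: J => [|k J IH] mE yE; first by rewrite big_nil mul0r oppr0 expR0.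
rewrite big_cons -natr1 mulrDl mul1r opprD expRD mulrC.
apply: ler_pM; rewrite ?pr_ge0 ?prodr_ge0 //; first by move=> *; exact: pr_ge0.
  by apply: IH => j jJ; [apply: mE|apply: yE]; rewrite inE jJ orbT.
rewrite pr_setC; last by apply: mE; rewrite inE eqxx.
apply: le_trans (expR_ge1Dx _); rewrite lerD2l lerN2.
by apply: yE; rewrite inE eqxx.
Qed.

Lemma pr_occurs_never (J : seq nat) (E : nat -> set Omega) y : uniq J ->
  (forall k, k \in J -> (0 < k)%N) -> (forall k, k \in J -> process_sigma (S k) (E k)) ->
  (forall k, k \in J -> y <= pr (E k)) ->
  pr (~` occurs J E) <= expR (- ((size J)%:R * y)).
Proof.
move=> uJ J0 JE yE; rewrite occursC setCK (pr_bigcap_process mS hindep) //.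
  by apply: prod_pr_setC_le => // k kJ; apply: (mS (J0 k kJ)); exact: JE.
by move=> k kJ; apply: process_sigma_setC; exact: JE.
Qed.

Variables t0 M : nat.

Definition block i : seq nat := iota (t0 + i * M).+1 M.

Lemma mem_block i k : (k \in block i) = (t0 + i * M < k <= t0 + i.+1 * M)%N.
Proof. by rewrite mem_iota mulSn; apply/idP/idP; lia. Qed.

Lemma block_gt0 i k : k \in block i -> (0 < k)%N.
Proof. by rewrite mem_block => /andP[+ _]; exact: leq_ltn_trans. Qed.

Definition all_blocks n (E : nat -> set Omega) : set Omega :=
  [set w | forall i, (i < n)%N -> occurs (block i) E w].

Lemma all_blocks0 E : all_blocks 0 E = setT.
Proof. by apply/seteqP; split. Qed.

Lemma all_blocksS n E : all_blocks n.+1 E = all_blocks n E `&` occurs (block n) E.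
Proof.
apply/seteqP; split=> [w h|w [h hn] i].
  by split=> [i ni|]; apply: h => //; exact: ltnW.
by rewrite ltnS leq_eqVlt => /predU1P[->//|]; exact: h.
Qed.

Lemma pr_all_blocksI n (A B : nat -> set Omega) :
  (forall k, (0 < k)%N -> process_sigma (S k) (A k)) ->
  (forall k, (0 < k)%N -> process_sigma (S k) (B k)) ->
  indep_after P S (t0 + n * M) (all_blocks n A `&` all_blocks n B) /\
  pr (all_blocks n A `&` all_blocks n B) = \prod_(i < n)
    (1 - \prod_(k <- block i) pr (~` A k) - \prod_(k <- block i) pr (~` B k)
     + \prod_(k <- block i) pr (~` A k `&` ~` B k)).
Proof.
move=> sA sB; elim: n => [|n [IH1 IH2]].
  rewrite !all_blocks0 setTI pr_setT big_ord0; split=> //.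
  exact: (indep_after_setT mS hindep).
rewrite !all_blocksS setIACA big_ord_recr /= -IH2 (occursC _ A) (occursC _ B).
apply: (indep_after_step mS IH1); first exact: iota_uniq.
- by move=> k; rewrite mem_block.
- by rewrite leq_add2l leq_mul2r leqnSn orbT.
- by move=> k /block_gt0 k0; apply: process_sigma_setC; exact: sA.
- by move=> k /block_gt0 k0; apply: process_sigma_setC; exact: sB.
Qed.

Lemma pr_all_blocks n (A : nat -> set Omega) :
  (forall k, (0 < k)%N -> process_sigma (S k) (A k)) ->
  pr (all_blocks n A) = \prod_(i < n) (1 - \prod_(k <- block i) pr (~` A k)).
Proof.
move=> sA; have [_] := pr_all_blocksI n sA sA; rewrite setIid => ->.
by apply: eq_bigr => i _; under [X in _ + X]eq_bigr do rewrite setIid; rewrite subrK.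
Qed.

Lemma measurable_all_blocks n (A : nat -> set Omega) :
  (forall k, (0 < k)%N -> process_sigma (S k) (A k)) -> measurable (all_blocks n A).
Proof. by move=> sA; have [[]] := pr_all_blocksI n sA sA; rewrite setIid. Qed.

(** One walk cannot serve both targets, so it misses both with probability 1 - a - b, at most (1 -
    a)(1 - b). This gives negative correlation within a block, and blocks multiply. *)
Lemma pr_all_blocks_neg_corr n (A B : nat -> set Omega) :
  (forall k, (0 < k)%N -> process_sigma (S k) (A k)) ->
  (forall k, (0 < k)%N -> process_sigma (S k) (B k)) ->
  (forall k w, A k w -> ~ B k w) ->
  pr (all_blocks n A `&` all_blocks n B) <= pr (all_blocks n A) * pr (all_blocks n B).
Proof.
move=> sA sB AB; have mA k : (0 < k)%N -> measurable (A k) by move=> k0; apply: (mS k0); exact: sA.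
have mB k : (0 < k)%N -> measurable (B k) by move=> k0; apply: (mS k0); exact: sB.
have [_ ->] := pr_all_blocksI n sA sB; rewrite !pr_all_blocks // -big_split /=.
apply: ler_prod => i _; apply/andP; split.
  (* The factor is nonnegative, being the probability that both targets are met within block [i]. *)
  have [] // := @indep_after_step _ _ _ _ P S mS 0 (t0 + i.+1 * M) setT (block i)
     (fun k => ~` A k) (fun k => ~` B k).
  - exact: (indep_after_setT mS hindep).
  - exact: iota_uniq.
  - by move=> k; rewrite mem_block => /andP[h ->]; rewrite (leq_ltn_trans _ h).
  - by move=> k /block_gt0 k0; apply: process_sigma_setC; exact: sA.
  - by move=> k /block_gt0 k0; apply: process_sigma_setC; exact: sB.
  by move=> _; rewrite pr_setT mul1r => <-; exact: pr_ge0.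
suff h : \prod_(k <- block i) pr (~` A k `&` ~` B k) <=
   \prod_(k <- block i) pr (~` A k) * \prod_(k <- block i) pr (~` B k) by nra.
rewrite -big_split /= !(big_seq _ _ (block i)) /=; apply: ler_prod => k /block_gt0 k0.
rewrite pr_ge0 /= setIC -setDE; have := pr_split P (measurableC (mB k k0)) (mA k k0).
rewrite (_ : ~` B k `&` A k = A k); last by rewrite setIC; apply/setIidPl => w /AB.
have := pr_ge0 P (A k); have := pr_ge0 P (B k); rewrite !pr_setC; [nra|exact: mA|exact: mB].
Qed.

(** A block of [M] walks succeeds with probability at least 1 - exp(-x), hence at least 1 - 1/(1 +
    x), which is at least x/2 as x is at most 1. *)
Lemma pr_all_blocks_ge n (A : nat -> set Omega) x :
  (forall k, (0 < k)%N -> process_sigma (S k) (A k)) -> 0 <= x <= 1 ->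
  (forall k, (0 < k)%N -> x / M%:R <= pr (A k)) -> (0 < M)%N ->
  (x / 2) ^+ n <= pr (all_blocks n A).
Proof.
move=> sA /andP[x0 x1] xA M0; rewrite pr_all_blocks // -[n in _ ^+ n]card_ord -prodr_const.
apply: ler_prod => i _; apply/andP; split; first by rewrite divr_ge0.
have : \prod_(k <- block i) pr (~` A k) <= expR (- ((size (block i))%:R * (x / M%:R))).
  apply: prod_pr_setC_le => k /block_gt0 k0; last exact: xA.
  by apply: (mS k0); exact: sA.
rewrite size_iota mulrC divfK ?pnatr_eq0 -?lt0n // expRN => h.
have e1 : 1 + x <= expR x := expR_ge1Dx x.
have : (expR x)^-1 <= (1 + x)^-1 by rewrite lef_pV2 // posrE; lra.
have h2 : (1 + x)^-1 <= 1 - x / 2.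
  by rewrite -[_^-1]mul1r ler_pdivrMr; nra.
lra.
Qed.

End Blocks.

(** * Growth of the cluster *)

Section Descent.
Variables (T : countType) (adj : rel T) (q : nat).
Hypotheses (hq : (3 <= q)%N) (hT : homogeneous_tree adj q).
Variable e : T.

Notation lev := (graph_dist adj e).

Fixpoint descent m x : seq T :=
  if m is k.+1 then let y := head x (children adj e x) in y :: descent k y else [::].

(** Every vertex has at least [q - 1] children, so [head] never falls back on its default and
    [descent] really goes down. *)
Lemma head_children x : head x (children adj e x) \in children adj e x.
Proof.
have := size_children hT e x.
by case: (children adj e x) => [|y s]; rewrite ?inE ?eqxx //= => ?; lia.
Qed.

Lemma path_descent m x : path adj x (descent m x).
Proof.
elim: m x => //= m IH x; rewrite IH andbT.
by have := head_children x; rewrite (mem_children hT) => /andP[].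
Qed.

Lemma size_descent m x : size (descent m x) = m.
Proof. by elim: m x => //= m IH x; rewrite IH. Qed.

Lemma lev_descent m x j : (j <= m)%N -> lev (nth x (x :: descent m x) j) = (lev x + j)%N.
Proof.
elim: m x j => [|m IH] x [|j] //; rewrite ?addn0 //= => jm.
have := head_children x; rewrite (mem_children hT) => /andP[_ /eqP hl].
rewrite -addSnnS -hl -IH //; congr lev; apply: set_nth_default.
by rewrite /= size_descent ltnS.
Qed.

Fixpoint ball_size n : nat :=
  if n is k.+1 then (ball_size k + level_size q k.+1)%N else 1%N.

Lemma ball_size_gt0 n : (0 < ball_size n)%N.
Proof. by elim: n => //= n IH; rewrite addn_gt0 IH. Qed.

Lemma ball_size_le n : (ball_size n <= level_size q n.+1)%N.
Proof.
elim: n => [|n IH]; first by rewrite /level_size /=; lia.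
rewrite /= [leqRHS]level_sizeS subn1.
by apply: leq_trans (_ : level_size q n.+1 * 2 <= _)%N; [lia|rewrite leq_mul2l; lia].
Qed.

(** Each further level at least doubles the ball. Giving up [s] levels thus leaves [2 ^ s] times as
    many walks as the smaller ball has vertices. *)
Lemma ball_size_double s n : (2 ^ s * ball_size n <= ball_size (n + s))%N.
Proof.
elim: s => [|s IH]; first by rewrite mul1n addn0.
by rewrite addnS /= expnS -mulnA mul2n -addnn leq_add // (leq_trans IH) // ball_size_le.
Qed.

Lemma sum_level_size n : (\sum_(l < n) level_size q l.+1)%N = (ball_size n).-1.
Proof.
elim: n => [|n IH]; first by rewrite big_ord0.
by rewrite big_ord_recr /= IH; have := ball_size_gt0 n; lia.
Qed.

Lemma ball_size_exp n : (ball_size n <= q ^ n.+1)%N.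
Proof.
apply: leq_trans (ball_size_le n) _; rewrite /level_size expnS leq_mul2l; case: n => [|n].
  by rewrite orbT.
by rewrite leq_exp2r // leq_pred orbT.
Qed.

(** The ball is listed level by level. A lower bound suffices, since the cluster grows with the
    number of walks. *)
Lemma gvolume_ge (R : realType) n : (ball_size n <= gvolume adj e (n%:R : R))%N.
Proof.
pose s := fix s n := if n is k.+1 then s k ++ level adj e k.+1 else level adj e 0.
have mem_s k x : (x \in s k) = (lev x <= k)%N.
  elim: k => [|k IH]; first by rewrite -[s 0%N]/(level adj e 0) (mem_level hT) leqn0.
  by rewrite -[s k.+1]/(s k ++ level adj e k.+1) mem_cat IH (mem_level hT) [RHS]leq_eqVlt orbC ltnS.
have uniq_s k : uniq (s k).
  elim: k => // k IH; rewrite -[s k.+1]/(s k ++ level adj e k.+1) cat_uniq IH (level_uniq hT) andbT.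
  by apply/hasPn => x; rewrite (mem_level hT) => /eqP lx; rewrite /= mem_s lx ltnn.
have size_s k : size (s k) = ball_size k.
  elim: k => // k IH; rewrite -[s k.+1]/(s k ++ level adj e k.+1) size_cat IH.
  by rewrite (size_level hT).
rewrite -size_s /gvolume; have -> : gball adj e (n%:R : R) = [set` s n].
  by apply/seteqP; split=> x; rewrite /gball /= mem_s ler_nat.
have -> : fset_set [set` s n] = [fset x in s n]%fset.
  apply/fsetP => x; rewrite in_fset_set ?inE; last exact: finite_seq.
  by apply/idP/idP; rewrite inE.
by rewrite card_fseq undup_id.
Qed.

End Descent.

(** * Filling a ball, then growing a path out of it *)

Section Idla.
Variables (R : realType) (T : countType) (adj : rel T) (q : nat).
Hypotheses (hq : (3 <= q)%N) (hT : homogeneous_tree adj q).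
Variables (e : T) (d : measure_display) (Omega : measurableType d).
Variables (P : probability Omega R) (S : nat -> nat -> Omega -> T).
Hypothesis hS : forall n, (0 < n)%N -> simple_random_walk P adj e (S n).
Hypothesis hindep : independent_processes P S.

Notation lev := (graph_dist adj e).
Notation pr := (pr P).
Notation D := (level_size q).

Let mS k E : (0 < k)%N -> process_sigma (S k) E -> measurable E.
Proof. by move=> k0; exact: (process_sigma_measurable (hS k0)). Qed.

Lemma idlaS n w : (0 < n)%N -> idla e S n.+1 w = idla e S n w `|`
  [set z | exists2 k, first_exit (idla e S n w) (fun j => S n.+1 j w) k & z = S n.+1 k w].
Proof. by case: n. Qed.

Local Arguments idla : simpl never.
Local Arguments level : simpl never.

Lemma idla_mono n n' w : (0 < n)%N -> (n <= n')%N -> idla e S n w `<=` idla e S n' w.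
Proof.
move=> n0; elim: n' => [|n' IH]; first by case: n n0.
rewrite leq_eqVlt => /predU1P[->//|nn']; apply: subset_trans (IH nn') _.
by rewrite [X in _ `<=` X]idlaS ?(leq_trans n0) // => z; left.
Qed.

(** The walk stays in the occupied ball until it reaches [v], then runs through the occupied
    beginning of the path. If vertex [i] of the path is still free, the first exit is there, at time
    [t + i]. *)
Lemma idla_hits n L p v w i : (0 < n)%N ->
  (forall x, (lev x < L)%N -> idla e S n w x) -> hits adj e (S n.+1) L p v w ->
  (i <= size p)%N -> (forall j, (j < i)%N -> idla e S n w (nth v (v :: p) j)) ->
  idla e S n.+1 w (nth v (v :: p) i).
Proof.
move=> n0 ball [t [h1 h2]] ip h; rewrite idlaS //.
have [Av|Av] := pselect (idla e S n w (nth v (v :: p) i)); [by left|right].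
exists (t + i)%N; last by rewrite h2.
split=> [|j]; first by rewrite /= h2.
case: (ltnP j t) => [jt _|tj jti]; first by apply: ball; exact: h1.
rewrite -(subnKC tj) /= h2; first by apply: h; lia.
by lia.
Qed.

(** The walk settles at [z] in one of countably many ways, given by the exit time and the sites
    visited before it. *)
Lemma measurable_idla n z : measurable [set w | idla e S n w z].
Proof.
elim: n z => [|n IH] z; first by rewrite (_ : mkset _ = set0) //; apply/seteqP; split.
case: (posnP n) => [->|n0].
  have [<-|ze] := eqVneq e z; first by rewrite (_ : mkset _ = setT) //; apply/seteqP; split.
  rewrite (_ : mkset _ = set0) //; apply/seteqP; split=> w //= ez.
  by rewrite ez eqxx in ze.
rewrite (_ : mkset _ = [set w | idla e S n w z] `|`
   \bigcup_k ((S n.+1 k @^-1` [set z] `\` [set w | idla e S n w z]) `&`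
      \bigcap_(j in [set j | (j < k)%N]) \bigcup_(y : T)
        (S n.+1 j @^-1` [set y] `&` [set w | idla e S n w y]))).
  apply: measurableU => //; apply: bigcupT_measurable => k; apply: measurableI.
    by apply: measurableD => //; case: (hS (ltn0Sn n)).
  case: k => [|k]; first by rewrite (_ : [set j | _] = set0) ?bigcap_set0 //; apply/seteqP; split.
  apply: bigcap_measurable; first by exists 0%N.
  move=> j _; apply: countable_bigcupT_measurable => [|y]; first exact: countableP.
  by apply: measurableI => //; case: (hS (ltn0Sn n)).
apply/seteqP; split=> w; rewrite /= idlaS //.
  case=> [Az|[k [nA hA] zk]]; [by left|right]; exists k => //.
  split; first by split=> //=; rewrite zk.
  by move=> j jk; exists (S n.+1 j w) => //; split=> //; exact: hA.
case=> [Az|[k _ [[/= zk nA] hA]]]; [by left|right]; exists k => //.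
split; first by rewrite zk.
by move=> j jk; have [y _ [/= -> ]] := hA j jk.
Qed.

Variable t : nat.

(* Walk number after which level l is expected to be filled. *)
Fixpoint fill_time l : nat :=
  if l is k.+1 then (fill_time k + 2 * D k.+1 * t)%N else 1%N.

Definition fill_block l : seq nat := iota (fill_time l).+1 (2 * D l.+1 * t).

Lemma fill_time_gt0 l : (0 < fill_time l)%N.
Proof. by elim: l => //= l IH; rewrite addn_gt0 IH. Qed.

Lemma fill_timeE l : fill_time l = (1 + 2 * t * (ball_size q l).-1)%N.
Proof.
elim: l => [|l IH] /=; first by rewrite muln0.
by rewrite IH; have := ball_size_gt0 q l; move: (ball_size q l) (D _); nia.
Qed.

(** Formulated with the full trajectories, regardless of where the walks settle: the conditions
    concern the walks alone, and their independence applies. *)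
Definition fill_success K : set Omega :=
  [set w | forall l v, (l < K)%N -> v \in level adj e l.+1 ->
    occurs (fill_block l) (fun k => hits adj e (S k) l.+1 [::] v) w].

(** Once the ball of radius [K] is full, a walk that first meets level [K.+1] at [x] settles there
    or finds [x] occupied. *)
Lemma fill_success_ball K w x : fill_success K w -> (lev x <= K)%N ->
  idla e S (fill_time K) w x.
Proof.
elim: K x => [|K IH] x hK xK.
  have -> : x = e by apply: (lev_eq0 hT); apply/eqP; rewrite -leqn0.
  by rewrite /fill_time /idla.
have {}IH y : (lev y <= K)%N -> idla e S (fill_time K) w y.
  by apply: IH => l v lK; apply: hK; exact: ltnW.
move: xK; rewrite leq_eqVlt => /predU1P[xK|xK]; last first.
  by apply: (idla_mono (fill_time_gt0 K)) (IH x xK); rewrite /= leq_addr.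
have [||k kJ hk] := hK K x; rewrite ?(mem_level hT) ?xK //.
move: kJ; rewrite mem_iota => /andP[k1 k2]; case: k k1 k2 hk => // k k1 k2 hk.
have k0 : (0 < k)%N by have := fill_time_gt0 K; lia.
apply: (@idla_mono k.+1) => //.
apply: (idla_hits (i := 0%N)) hk _ _ => // y yK.
by apply: (idla_mono (fill_time_gt0 K)) (IH y yK).
Qed.

Lemma process_sigma_hitsS L p v k : process_sigma (S k) (hits adj e (S k) L p v).
Proof. exact: process_sigma_hits. Qed.

(** Union bound over the vertices of levels 1 to [K], each missed with probability at most
    [expR (- t%:R)]. *)
Lemma fill_failure K : exists F : set Omega, [/\ measurable F,
  forall w, ~ F w -> fill_success K w &
  pr F <= (ball_size q K)%:R * expR (- t%:R)].
Proof.
pose I := [seq (l, v) | l <- iota 0 K, v <- level adj e l.+1].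
pose E (lv : nat * T) := ~` occurs (fill_block lv.1) (fun k => hits adj e (S k) lv.1.+1 [::] lv.2).
have mE lv : measurable (E lv).
  apply: measurableC; apply: (measurable_occurs mS) => k; rewrite mem_iota.
    by case: k.
  by move=> _; exact: process_sigma_hitsS.
exists (\big[setU/set0]_(i <- I) E i); split.
- by apply: bigsetU_measurable.
- move=> w nF l v lK vl; apply: contrapT => nE; apply: nF.
  rewrite -bigcup_seq; exists (l, v) => //=.
  by apply/allpairsPdep; exists l, v; rewrite mem_iota.
apply: le_trans (_ : \sum_(i <- I) pr (E i) <= _).
  apply: pr_le_sum => //; first exact: bigsetU_measurable.
  by move=> w; rewrite -bigcup_seq => -[i iI Ei]; exists i.
rewrite big_allpairs_dep /=.
apply: le_trans (_ : \sum_(l <- iota 0 K) (D l.+1)%:R * expR (- t%:R) <= _).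
  apply: ler_sum => l _; rewrite big_seq.
  apply: le_trans (_ : \sum_(v <- level adj e l.+1 | v \in level adj e l.+1) expR (- t%:R) <= _).
    apply: ler_sum => v vl; rewrite (mem_level hT) in vl.
    (* Number of walks in the block times the lower bound of [hits_ge] for a single walk. *)
    have -> : t%:R = (size (fill_block l))%:R * (2 * (D l.+1)%:R)^-1 :> R.
      have D0 : (D l.+1)%:R != 0 :> R by rewrite pnatr_eq0 -lt0n level_size_gt0.
      by rewrite size_iota (natrM _ _ t) (natrM _ 2) mulrAC mulfV ?mul1r // mulf_neq0 // pnatr_eq0.
    apply: (pr_occurs_never mS hindep); first exact: iota_uniq.
    - by move=> k; rewrite mem_iota; case: k.
    - by move=> k _; exact: process_sigma_hitsS.
    - move=> k; rewrite mem_iota; case: k => // k _.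
      by have := hits_ge hq hT (hS (ltn0Sn k)) (p := [::]) (eqP vl) isT; rewrite expr0 mul1r.
  by rewrite -big_seq big_const_seq count_predT (size_level hT) iter_addr_0 mulr_natl.
rewrite -mulr_suml ler_wpM2r ?expR_ge0 // -natr_sum ler_nat.
have -> : (\sum_(l <- iota 0 K) D l.+1)%N = (ball_size q K).-1.
  transitivity (\sum_(0 <= l < K) D l.+1)%N; first by rewrite /index_iota subn0.
  by rewrite big_mkord sum_level_size.
exact: leq_pred.
Qed.

Variables L m : nat.
Hypothesis L0 : (0 < L)%N.

Let M := (2 * D L)%N.
Let t0 := fill_time L.-1.

(** One block for each of the [m.+1] vertices of the path. The block length [M] cancels the factor
    [2 * D L] of [hits_ge], leaving [q%:R^-1 ^+ m] as the expected number of successes guaranteed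
    per block. *)
Let tentacle v : set Omega :=
  all_blocks t0 M m.+1 (fun k => hits adj e (S k) L (descent adj e m v) v).

(** By induction, the first [n] vertices of the path are occupied after [n] blocks: the successful
    walk of the next block is carried to the next vertex. *)
Lemma tentacle_idla v w : fill_success L.-1 w -> tentacle v w ->
  forall j, (j <= m)%N -> idla e S (t0 + m.+1 * M) w (nth v (v :: descent adj e m v) j).
Proof.
move=> hfill hten j jm.
suff h n : (n <= m.+1)%N -> forall j, (j < n)%N ->
    idla e S (t0 + n * M) w (nth v (v :: descent adj e m v) j) by apply: h.
elim: n {j jm} => // n IH nm j; rewrite ltnS leq_eqVlt => jn.
have jn' : (j <= n)%N by case/predU1P: jn => [->|/ltnW].
have [k] := hten n nm; rewrite mem_block => /andP[k1 k2]; case: k k1 k2 => // k k1 k2 hk.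
have t00 : (0 < t0)%N by exact: fill_time_gt0.
have k0 : (0 < k)%N by lia.
apply: (@idla_mono k.+1) => //.
apply: idla_hits hk _ _ => //.
- move=> x xL; apply: (@idla_mono t0) => //; first by lia.
  by apply: fill_success_ball => //; lia.
- by rewrite size_descent; lia.
- move=> i ij; apply: (@idla_mono (t0 + n * M)) => //; first by lia.
  by apply: IH; [exact: ltnW|lia].
Qed.

(** Second moment method over the vertices of level [L]. By [hits_inj], one walk cannot first meet
    the level at two vertices, whence the negative correlation. *)
Lemma tentacle_failure : exists F : set Omega, [/\ measurable F,
  forall w, ~ F w -> exists2 v, v \in level adj e L & tentacle v w &
  pr F * ((D L)%:R * (q%:R^-1 ^+ m / 2) ^+ m.+1) <= 1].
Proof.
have mt v : measurable (tentacle v).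
  by apply: (measurable_all_blocks mS hindep) => k _; exact: process_sigma_hitsS.
pose N := ~` \big[setU/set0]_(v <- level adj e L) tentacle v.
have mN : measurable N by apply: measurableC; exact: bigsetU_measurable.
exists N; split=> //.
  by move=> w; rewrite /N -bigcup_seq => /contrapT[v vL hv]; exists v.
have q0 : 0 < q%:R :> R by rewrite ltr0n; lia.
have LS : L = L.-1.+1 by rewrite prednK.
apply: le_trans (_ : pr N * \sum_(v <- level adj e L) pr (tentacle v) <= _).
  rewrite ler_wpM2l ?pr_ge0 //.
  apply: le_trans (_ : \sum_(v <- level adj e L) (q%:R^-1 ^+ m / 2) ^+ m.+1 <= _).
    by rewrite big_const_seq count_predT (size_level hT) iter_addr_0 mulr_natl.
  rewrite big_seq [leRHS]big_seq; apply: ler_sum => v vL; rewrite (mem_level hT) in vL.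
  apply: (pr_all_blocks_ge mS hindep).
  - by move=> k _; exact: process_sigma_hitsS.
  - rewrite exprn_ge0 ?invr_ge0 ?ler0n //= exprn_ile1 ?invr_ge0 ?ler0n //.
    by rewrite invf_le1 // ler1n; lia.
  - move=> k k0; have := hits_ge hq hT (hS k0) (x := v) (p := descent adj e m v) (L := L.-1).
    by rewrite -LS size_descent natrM; apply; [exact: (eqP vL)|exact: (path_descent hq hT)].
  - by rewrite /M muln_gt0 level_size_gt0.
apply: second_moment => //; first exact: (level_uniq hT).
  by move=> v w vL; rewrite /N -bigcup_seq => h hv; apply: h; exists v.
move=> v v' vL v'L vv'; apply: (pr_all_blocks_neg_corr mS hindep).
- by move=> k _; exact: process_sigma_hitsS.
- by move=> k _; exact: process_sigma_hitsS.
move=> k w h h'; move: vv'; rewrite (mem_level hT) in vL; rewrite (mem_level hT) in v'L.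
by rewrite (hits_inj (eqP vL) (eqP v'L) h h') eqxx.
Qed.

Lemma idla_reaches N : (t0 + m.+1 * M <= N)%N -> exists F : set Omega, [/\ measurable F,
  forall w, ~ F w -> forall j, (j <= L + m)%N -> exists2 x, lev x = j & idla e S N w x &
  pr F <= (ball_size q L)%:R * expR (- t%:R) +
          ((D L)%:R * (q%:R^-1 ^+ m / 2) ^+ m.+1)^-1].
Proof.
move=> hN; have [F1 [mF1 hF1 pF1]] := fill_failure L.-1.
have [F2 [mF2 hF2 pF2]] := tentacle_failure.
have q0 : 0 < q%:R :> R by rewrite ltr0n; lia.
exists (F1 `|` F2); split.
- exact: measurableU.
- move=> w nF j jLm.
  have {}hF1 : fill_success L.-1 w by apply: hF1 => h; apply: nF; left.
  have [v vL hv] : exists2 v, v \in level adj e L & tentacle v w.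
    by apply: hF2 => h; apply: nF; right.
  rewrite (mem_level hT) in vL; have t00 : (0 < t0)%N by exact: fill_time_gt0.
  have [jL|Lj] := ltnP j L; last first.
    exists (nth v (v :: descent adj e m v) (j - L)).
      by rewrite (lev_descent hq hT) ?(eqP vL); lia.
    apply: (idla_mono _ hN); first by lia.
    by apply: tentacle_idla => //; lia.
  have [x xj] : exists x, x \in level adj e j.
    have := size_level hT e j; have := level_size_gt0 hq j.
    by case: (level adj e j) => [|x s] h1 h2; [rewrite -h2 in h1|exists x; rewrite inE eqxx].
  rewrite (mem_level hT) in xj; exists x; first exact: (eqP xj).
  apply: (@idla_mono t0) => //; first by lia.
  by apply: fill_success_ball => //; rewrite (eqP xj); lia.
apply: le_trans (pr_setU_le P mF1 mF2) _; apply: lerD.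
  apply: le_trans pF1 _; rewrite ler_wpM2r ?expR_ge0 // ler_nat.
  by rewrite -{2}(prednK L0) /= leq_addr.
rewrite -[_^-1]mul1r ler_pdivlMr // mulr_gt0 ?ltr0n ?level_size_gt0 //.
by rewrite exprn_gt0 // divr_gt0 // exprn_gt0 // invr_gt0.
Qed.

End Idla.

(** * Choice of the parameters *)

Section Asymptotics.
Variable R : realType.

(** Equality holds at [s = 3]; from there on the cube less than doubles at each step. *)
Lemma cube_le_exp2 s : (s.+1 ^ 3 <= 8 * 2 ^ s)%N.
Proof.
case: s => [|[|[|s]]] //; elim: s => // s IH.
rewrite [(2 ^ s.+4)%N]expnS mulnCA.
apply: leq_trans (_ : 2 * s.+4 ^ 3 <= _)%N; last by rewrite leq_mul2l IH.
by rewrite !expnS expn0; nia.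
Qed.

Lemma lime_geometric_lty (u : nat -> \bar R) (K r : R) : 0 <= K -> 0 <= r < 1 ->
  (forall n, 0 <= u n)%E -> (forall n, u n <= (K * r ^+ n)%:E)%E ->
  (\sum_(0 <= n <oo) u n < +oo)%E.
Proof.
move=> K0 /andP[r0 r1] u0 uK.
apply: (@le_lt_trans _ _ (K / (1 - r))%:E); last exact: ltry.
apply: lime_le; first by apply: is_cvg_nneseries => n _ _; exact: u0.
apply: nearW => n; apply: (@le_trans _ _ (\sum_(0 <= i < n) (K * r ^+ i)%:E)%E).
  by apply: lee_sum => i _; exact: uK.
rewrite sumEFin lee_fin -mulr_sumr ler_wpM2l //.
have r1' : 0 < 1 - r by lra.
rewrite -[leRHS]mul1r ler_pdivlMr //.
have -> : (\sum_(0 <= i < n) r ^+ i) * (1 - r) = 1 - r ^+ n.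
  by rewrite big_mkord mulrC -opprB mulNr -subrX1 opprB.
by rewrite gerBl exprn_ge0.
Qed.

Variable q : nat.
Hypothesis hq : (3 <= q)%N.

Let a : R := ln (q%:R - 1).
Let b : R := ln q%:R.

(* A redex, since lra does not see through the cast in 2 <= q%:R - 1 :> R. *)
Let q1 : (fun x : R => 2 <= x - 1) q%:R.
Proof. by rewrite /= lerBrDr -natr1 -[1 + 1]/(2%:R) (natr1 2) ler_nat. Qed.

Let b_gt0 : 0 < b. Proof. by have /= q1' := q1; rewrite ln_gt0 //; lra. Qed.

Let a_gt0 : 0 < a. Proof. by have /= q1' := q1; rewrite ln_gt0 //; lra. Qed.

Let ab : a < b. Proof. by have /= q1' := q1; rewrite ltr_ln ?posrE; lra. Qed.

Let ln2b : ln 2 <= b. Proof. by have /= q1' := q1; rewrite ler_ln ?posrE; lra. Qed.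

(** Choice of [t = q * n] in the filling bound: the ball has at most q^(n+1) vertices, and q is at
    most exp(q - 1). *)
Lemma ball_size_decay n : (ball_size q n)%:R * expR (- (q * n)%:R) <= q%:R * expR (- n%:R) :> R.
Proof.
have /= q1' := q1.
have h : (ball_size q n)%:R <= q%:R ^+ n.+1 :> R by rewrite -natrX ler_nat ball_size_exp.
apply: le_trans (ler_wpM2r (expR_ge0 _) h) _.
rewrite exprS -mulrA ler_wpM2l ?ler0n //.
apply: le_trans (_ : expR (q%:R - 1) ^+ n * expR (- (q * n)%:R) <= _).
  rewrite ler_wpM2r ?expR_ge0 // lerXn2r ?nnegrE ?expR_ge0 ?ler0n //.
  by apply: le_trans (expR_ge1Dx _); lra.
rewrite -expRM_natl -expRD ler_expR natrM; lra.
Qed.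

(** The level size is at least (q - 1)^L; the other factor is turned into an exponential exactly. *)
Lemma tentacle_mass (L m : nat) : (0 < L)%N ->
  expR (L%:R * a - m.+1%:R * (m%:R * b + ln 2)) <=
  (level_size q L)%:R * (q%:R^-1 ^+ m / 2) ^+ m.+1.
Proof.
move=> L0; have /= q1' := q1; have q0 : 0 < q%:R :> R by lra.
have q10 : 0 < q%:R - 1 :> R by lra.
rewrite expRD; apply: ler_pM; rewrite ?expR_ge0 //.
  rewrite expRM_natl lnK ?posrE // -(prednK L0) /level_size natrM natrX exprS.
  have -> : q.-1%:R = q%:R - 1 :> R by rewrite -subn1 natrB //; lia.
  by rewrite ler_wpM2r ?exprn_ge0 ?ltW //; lra.
rewrite -mulrN expRM_natl opprD expRD expRN expRM_natl lnK ?posrE //.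
by rewrite expRN lnK ?posrE // exprVn.
Qed.

Variable C : R.
Hypothesis hC : C < Num.sqrt (a / b).

(** [C0] takes care of negative [C]. The midpoint [c = C0 + eps] lies strictly between [C0] and the
    threshold [thr], where [thr ^+ 2 * b = a]; hence the margin [del] is positive. *)
Let C0 : R := Num.max C 0.
Let thr : R := Num.sqrt (a / b).
Let c : R := (C0 + thr) / 2.
Let eps : R := (thr - C0) / 2.
Let del : R := (a - c ^+ 2 * b) / 2.

Let thr_gt0 : 0 < thr. Proof. by rewrite sqrtr_gt0 divr_gt0. Qed.

Let thr_sq : thr ^+ 2 * b = a.
Proof. by rewrite sqr_sqrtr ?divfK // ?lt0r_neq0 // ltW // divr_gt0. Qed.

Let thr_le1 : thr <= 1.
Proof. by rewrite /thr -sqrtr1 ler_sqrt // ler_pdivrMr // mul1r ltW. Qed.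

Let C0_ge0 : 0 <= C0. Proof. by rewrite le_max lexx orbT. Qed.

Let C0_thr : C0 < thr. Proof. by rewrite gt_max hC thr_gt0. Qed.

Let del_gt0 : 0 < del.
Proof.
have h0 := C0_ge0; have h1 := C0_thr.
have c0 : 0 <= c by rewrite /c; lra.
have ct : c < thr by rewrite /c; lra.
by rewrite /del divr_gt0 // subr_gt0 -thr_sq ltr_pM2r // ltr_pXn2r // nnegrE ltW // thr_gt0.
Qed.

Definition slack n : nat := Num.truncn (eps * Num.sqrt n%:R).
(** Makes up for the [slack n] levels given up, then goes to the first level beyond radius
    [n + C0 * sqrt n]. *)
Definition tail_length n : nat := (slack n + (Num.truncn (C0 * Num.sqrt n%:R)).+1)%N.

(** The tail length is at most [c * sqrt n + 1], so the exponent is at least [2 * del * n] up to an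
    error of order [sqrt n]; and [2 ^ slack n] outgrows every multiple of [n]. *)
Lemma parameters : exists2 delta : R, 0 < delta & exists n0, forall n, (n0 <= n)%N ->
  [/\ (slack n < n)%N, (2 * (q * n + (tail_length n).+1) <= 2 ^ slack n)%N,
      - C <= Num.sqrt n%:R &
      delta * n%:R <= (n - slack n)%:R * a -
        (tail_length n).+1%:R * ((tail_length n)%:R * b + ln 2)].
Proof.
have /= hq1 := q1; have ht0 := thr_gt0; have ht1 := thr_le1; have hC0 := C0_ge0.
have hCt := C0_thr; have ha := a_gt0; have hb := b_gt0; have hab := ab.
have hd := del_gt0; have hln2 := ln2b.
have eps_gt0 : 0 < eps by rewrite /eps; lra.
(* [u] bounds the [sqrt n] from which (slack n + 1)^3 is at least 16(q + 3)n, as the second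
   condition requires. [v] bounds the one from which the errors, 8 in [t2] and 1 in [t3] times
   [b * sqrt n], are below [del * n]. *)
have [u hu] : exists u, u = 16 * (q%:R + 3) / eps ^+ 3 by eexists.
have [v hv] : exists v, v = 9 * b / del by eexists.
have h1 : 0 <= u by rewrite hu divr_ge0 ?exprn_ge0 ?ltW // mulr_gt0 //; lra.
have h2 : 0 <= v by rewrite hv divr_ge0 ?ltW // mulr_gt0.
pose X := 2 + `|C| + u + v.
have h3 := normr_ge0 C.
exists del => //; exists (Num.truncn (X ^+ 2)).+1 => n hn.
pose x := Num.sqrt n%:R : R.
have xn : x ^+ 2 = n%:R by rewrite sqr_sqrtr ?ler0n.
have x0 : 0 <= x by rewrite sqrtr_ge0.
have Xx : X <= x.
  rewrite -(@ler_pXn2r _ 2) ?nnegrE //; last by rewrite /X; lra.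
  rewrite xn; apply: ltW; apply: lt_le_trans (_ : (Num.truncn (X ^+ 2)).+1%:R <= _).
    by have /andP[] := truncn_itv (sqr_ge0 X).
  by rewrite ler_nat.
have x2 : 2 <= x by rewrite /X in Xx; lra.
have xC : - C <= x by rewrite /X in Xx; have := ler_norm (- C); rewrite normrN; lra.
have xq : 16 * (q%:R + 3) <= eps ^+ 3 * x.
  by rewrite [leRHS]mulrC -ler_pdivrMr ?exprn_gt0 // -hu; rewrite /X in Xx; lra.
have xb : 9 * b <= del * x by rewrite [leRHS]mulrC -ler_pdivrMr // -hv; rewrite /X in Xx; lra.
have /andP[s1 s2] : (slack n)%:R <= eps * x < (slack n).+1%:R.
  by apply: truncn_itv; exact: mulr_ge0 (ltW eps_gt0) x0.
have /andP[j1 j2] : (Num.truncn (C0 * x))%:R <= C0 * x < (Num.truncn (C0 * x)).+1%:R.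
  by apply: truncn_itv; exact: mulr_ge0.
set s := slack n in s1 s2 *.
have mle : (tail_length n)%:R <= c * x + 1.
  rewrite /tail_length -/s -/x natrD -natr1.
  have -> : c * x = eps * x + C0 * x by rewrite /c /eps; field.
  lra.
set m := tail_length n in mle *.
have c1 : c <= 1 by rewrite /c; lra.
have c0 : 0 <= c by rewrite /c; lra.
have eps1 : eps <= 1 by rewrite /eps; lra.
have sn : (s < n)%N by rewrite -(ltr_nat R) -xn; nra.
split=> //.
  rewrite -(@leq_pmul2l 8) //; apply: leq_trans (cube_le_exp2 s).
  rewrite -(ler_nat R) natrX; apply: le_trans (_ : (eps * x) ^+ 3 <= _); last first.
    by rewrite lerXn2r ?nnegrE ?ler0n ?(mulr_ge0 (ltW eps_gt0)) // ltW.
  rewrite exprMn [x ^+ 3]exprS mulrA !natrM natrD natrM -natr1 -xn.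
  have m1 : m%:R + 1 <= 3 * x ^+ 2 by nra.
  by have := ler_wpM2r (sqr_ge0 x) xq; lra.
rewrite natrB 1?ltnW // -natr1 -xn.
have m0 : 0 <= m%:R :> R by rewrite ler0n.
have ln20 : 0 <= ln 2 :> R by rewrite ln_ge0 // ler1n.
have t1 : (m%:R + 1) * (m%:R * b + ln 2) <= (c * x + 2) * ((c * x + 1) * b + b).
  apply: ler_pM; [by rewrite addr_ge0| |lra|].
    by rewrite addr_ge0 // mulr_ge0 // ltW.
  by apply: lerD => //; rewrite ler_wpM2r // ltW.
have cx : c * x <= x by nra.
have t2 : (c * x + 2) * ((c * x + 1) * b + b) <= c ^+ 2 * b * x ^+ 2 + 8 * (b * x).
  have -> : (c * x + 2) * ((c * x + 1) * b + b) =
      c ^+ 2 * b * x ^+ 2 + 4 * (c * x * b) + 4 * b by ring.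
  have f1 : c * x * b <= x * b by rewrite ler_wpM2r // ltW.
  have f2 : 0 <= (x - 2) * b by rewrite mulr_ge0 ?subr_ge0 ?(ltW hb).
  lra.
have t3 : s%:R * a <= b * x.
  rewrite mulrC; apply: ler_pM => //; [exact: ltW|exact: ltW|nra].
have t4 : 9 * (b * x) <= del * x ^+ 2.
  by have := ler_wpM2r x0 xb; rewrite expr2 !mulrA.
have : c ^+ 2 * b * x ^+ 2 = a * x ^+ 2 - 2 * (del * x ^+ 2) by rewrite /del; field.
by rewrite mulrBl; lra.
Qed.

End Asymptotics.

(** Off [F], the cluster contains a vertex on each level up to [L + m], in particular one on the
    level just outside the ball. *)
Lemma idla_avoids_exp (R : realType) (q : nat) (hq : (3 <= q)%N)
    (T : countType) (adj : rel T) (hT : homogeneous_tree adj q) (e : T)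
    (d : measure_display) (Omega : measurableType d) (P : probability Omega R)
    (S : nat -> nat -> Omega -> T)
    (hS : forall n, (0 < n)%N -> simple_random_walk P adj e (S n))
    (hindep : independent_processes P S)
    (C : R) (hC : C < Num.sqrt (ln (q%:R - 1) / ln q%:R)) :
  exists2 delta : R, 0 < delta & exists n0, forall n, (n0 <= n)%N ->
    exists F : set Omega, [/\ measurable F,
      [set w | idla e S (gvolume adj e (n%:R : R)) w `&`
               gboundary adj e (n%:R + C * Num.sqrt n%:R) = set0] `<=` F &
      pr P F <= q%:R * expR (- n%:R) + expR (- (delta * n%:R))].
Proof.
have [delta delta0 [n0 hpar]] := parameters hq hC.
exists delta => //; exists n0 => n /hpar[]; set s := slack q C n; set m := tail_length q C n.
move=> sn hexp Cn hmass; pose L := (n - s)%N.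
have L0 : (0 < L)%N by rewrite subn_gt0.
pose t := (q * n)%N.
have t_gt0 : (0 < t)%N by rewrite muln_gt0; lia.
(* The walks used number at most [2 * (t + m.+1) * ball_size q L], hence at most
   [2 ^ s * ball_size q L], which [ball_size_double] bounds by the volume of the full ball. *)
have hN : (fill_time q t L.-1 + m.+1 * (2 * level_size q L) <= gvolume adj e (n%:R : R))%N.
  apply: leq_trans (gvolume_ge hT e R n).
  rewrite -[X in ball_size q X](subnK (ltnW sn)) -/L; apply: leq_trans (ball_size_double hq s L).
  apply: leq_trans (leq_mul hexp (leqnn _)); rewrite -/t fill_timeE //.
  have -> : ball_size q L = (ball_size q L.-1 + level_size q L)%N.
    by rewrite -{1}(prednK L0) /= prednK.
  have := ball_size_gt0 q L.-1; move: (ball_size q _) (level_size q L) t_gt0 => B D' ? ?; nia.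
have [F [mF hF pF]] := idla_reaches hq hT hS hindep L0 hN.
exists F; split => //.
- move=> w /= hw; apply: contrapT => /hF hj.
  set r := n%:R + C * Num.sqrt n%:R in hw.
  have x0 : 0 <= Num.sqrt n%:R :> R by rewrite sqrtr_ge0.
  have xx : Num.sqrt n%:R * Num.sqrt n%:R = n%:R :> R by rewrite -expr2 sqr_sqrtr.
  (* For negative [C] this uses [- C <= sqrt n]. With a negative radius the ball and its boundary
     would be empty and the claim would fail. *)
  have r0 : 0 <= r.
    by rewrite /r -[X in X + _]xx -mulrDl mulr_ge0 // -lerBlDr sub0r.
  have /andP[j1 j2] := truncn_itv r0; set j := Num.truncn r in j1 j2.
  have C00 : 0 <= Num.max C 0 * Num.sqrt n%:R by rewrite mulr_ge0 // le_max lexx orbT.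
  have jle : (j.+1 <= L + m)%N.
    have -> : (L + m)%N = (n + (Num.truncn (Num.max C 0 * Num.sqrt n%:R)%R).+1)%N.
      by rewrite /m /tail_length -/s /L addnA subnK // ltnW.
    rewrite addnS ltnS -ltnS -(ltr_nat R); apply: le_lt_trans j1 _.
    rewrite -addnS natrD ltrD2l; have /andP[_] := truncn_itv C00.
    by apply: le_lt_trans; rewrite ler_wpM2r // le_max lexx.
  have [z zj Az] := hj _ jle.
  have : (idla e S (gvolume adj e (n%:R : R)) w `&` gboundary adj e r) z.
    split => //; split; first by rewrite /gball /= zj; apply/negP; rewrite -ltNge.
    (* The parent of [z], on level [j = floor r], lies in the ball. *)
    have [y zy yj] := lev_pred hT zj; exists y => //.
    by rewrite /gball /= yj.
  by rewrite hw.
apply: le_trans pF _; apply: lerD.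
  apply: le_trans (ball_size_decay R hq n); rewrite ler_wpM2r ?expR_ge0 // ler_nat.
  have := ball_size_double hq s L; rewrite subnK ?(ltnW sn) //; apply: leq_trans.
  by rewrite leq_pmull // expn_gt0.
rewrite expRN lef_pV2 ?posrE ?expR_gt0 //; last first.
  by apply: lt_le_trans (tentacle_mass R hq m L0); exact: expR_gt0.
by apply: le_trans (tentacle_mass R hq m L0); rewrite ler_expR.
Qed.

Theorem proposition4p1 (R : realType) (q : nat) (hq : (3 <= q)%N)
    (T : countType) (adj : rel T) (hT : homogeneous_tree adj q) (e : T)
    (d : measure_display) (Omega : measurableType d) (P : probability Omega R)
    (S : nat -> nat -> Omega -> T)
    (hS : forall n, (0 < n)%N -> simple_random_walk P adj e (S n))
    (hindep : independent_processes P S)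
    (C : R) (hC : C < Num.sqrt (ln (q%:R - 1) / ln q%:R)) :
  P (lim_sup_set (fun n : nat =>
       [set w | idla e S (gvolume adj e (n%:R : R)) w `&`
                gboundary adj e (n%:R + C * Num.sqrt n%:R) = set0])) = 0%E.
Proof.
have [delta delta0 [n0 hF]] := idla_avoids_exp hq hT hS hindep hC.
set E := fun n : nat => _.
have mE n : measurable (E n).
  rewrite (_ : E n = ~` \bigcup_(z : T) [set w |
      gboundary adj e (n%:R + C * Num.sqrt n%:R) z /\
      idla e S (gvolume adj e (n%:R : R)) w z]).
    apply/measurableC/countable_bigcupT_measurable => [|z]; first exact: countableP.
    have [bz|bz] := pselect (gboundary adj e (n%:R + C * Num.sqrt n%:R) z).
      have := measurable_idla hS (gvolume adj e (n%:R : R)) z.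
      by congr measurable; apply/seteqP; split=> w //= -[].
    by rewrite (_ : mkset _ = set0) //; apply/seteqP; split=> w // -[].
  apply/seteqP; split=> [w Ew [z _ [bz Az]]|w nA].
    by have : set0 z by rewrite -Ew.
  by apply/seteqP; split=> z // [Az bz]; apply: nA; exists z.
(* A common ratio: both exponential terms are at most multiples of [r ^+ n]. *)
pose r := expR (- Num.min delta 1).
have m0 : 0 < Num.min delta 1 by rewrite lt_min delta0 ltr01.
have r0 : 0 < r by exact: expR_gt0.
have r1 : r < 1 by rewrite /r expR_lt1 oppr_lt0.
have rn n : r ^+ n = expR (- (n%:R * Num.min delta 1)) by rewrite -expRM_natl mulrN.
apply: lim_sup_set_cvg0 => //.
(* The summand [(r ^+ n0)^-1] covers the indices below [n0], where it makes the bound at least 1;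
   [q%:R + 1] covers the others. *)
apply: (@lime_geometric_lty _ _ (q%:R + 1 + (r ^+ n0)^-1) r).
- by rewrite !addr_ge0 // invr_ge0 exprn_ge0 // ltW.
- by rewrite (ltW r0) r1.
- by move=> n; exact: measure_ge0.
move=> n; rewrite /= (prE P (mE n)) lee_fin.
have [n0n|nn0] := leqP n0 n; last first.
  apply: le_trans (pr_le1 P (mE n)) _; rewrite mulrDl.
  have h1 : 1 <= (r ^+ n0)^-1 * r ^+ n.
    rewrite mulrC ler_pdivlMr ?exprn_gt0 // mul1r.
    by apply: (ler_wiXn2l (ltW r0) (ltW r1)); exact: ltnW.
  by apply: le_trans h1 _; rewrite lerDr mulr_ge0 ?exprn_ge0 ?addr_ge0 // ltW.
have [F [mF EF pF]] := hF n n0n.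
apply: le_trans (le_pr P (mE n) mF EF) _; apply: le_trans pF _.
rewrite mulrDl -[leLHS]addr0; apply: lerD; last first.
  by rewrite mulr_ge0 ?invr_ge0 ?exprn_ge0 // ltW.
rewrite mulrDl mul1r rn; apply: lerD.
  rewrite ler_wpM2l ?ler0n // ler_expR lerN2 -[leRHS]mulr1.
  by rewrite ler_wpM2l ?ler0n // ge_min lexx orbT.
by rewrite ler_expR lerN2 mulrC ler_wpM2r ?ler0n // ge_min lexx.
Qed.
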